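(* Let $\dim(\mathcal{X})<\infty$. Suppose $(x,x^* )\in \Pi$ is such that $x\in E_{\mathcal{X}}$ and $x^*\in E_{\mathcal{X}^*}$. Suppose that at least one of the following holds: (i) either $x$ or $x^*$ is smooth; (ii) $x$ is an exposed point. Then for each $(\alpha_1,\ldots,\alpha_d)\in S_{\ell_q^d}$, $(\alpha_1x^*\otimes x,\ldots,\alpha_dx^*\otimes x)\in E_{\mathcal{Z}^*}$.
   Context: $\mathcal{X}$ is a nonzero Banach space over $\mathbb{F}$ ($\mathbb{R}$ or $\mathbb{C}$) with dual $\mathcal{X}^*$. For a normed space $\mathcal{Y}$, $B_{\mathcal{Y}}$ is its closed unit ball, $S_{\mathcal{Y}}$ its unit sphere, and $E_{\mathcal{Y}}$ the set of extreme points of $B_{\mathcal{Y}}$. A nonzero vector $y\in\mathcal{Y}$ is smooth if $J(y)=\{f\in\mathcal{Y}^*:\|f\|=1, f(y)=\|y\|\}$ is a singleton (for $x^*$ this is applied with $\mathcal{Y}=\mathcal{X}^*$). A vector $x\in S_{\mathcal{X}}$ is an exposed point of $\mathcal{X}$ if there is a hyperplane (a translate of a hyperspace, i.e. of a codimension-one subspace) $H$ with $S_{\mathcal{X}}\cap H=\{x\}$. $\mathcal{L}(\mathcal{X})$ is the space of bounded linear operators on $\mathcal{X}$; $\Pi=\{(x,x^* ): x\in S_{\mathcal{X}},\ x^*\in S_{\mathcal{X}^*},\ x^*(x)=1\}$. Standing assumption: the numerical radius $w(T)=\sup\{|x^*(Tx)|:(x,x^* )\in\Pi\}$ is a norm on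 $\mathcal{L}(\mathcal{X})$ (automatic if $\mathbb{F}=\mathbb{C}$). Fix an integer $d\ge 1$ and $1<p<\infty$, and let $\frac1p+\frac1q=1$. The joint numerical radius of $\mathcal{T}=(T_1,\ldots,T_d)\in\mathcal{L}(\mathcal{X})^d$ is $w_p(\mathcal{T})=\sup\{(\sum_{i=1}^d|x^*(T_ix)|^p)^{1/p}:(x,x^* )\in\Pi\}$, and $\mathcal{Z}=(\mathcal{L}(\mathcal{X})^d,w_p(\cdot))$, with dual $\mathcal{Z}^*$ carrying the dual norm. $\ell_q^d$ is $\mathbb{F}^d$ with the $q$-norm. For $\alpha_i\in\mathbb{F}$, $x\in\mathcal{X}$, $x^*\in\mathcal{X}^*$, $(\alpha_1x^*\otimes x,\ldots,\alpha_dx^*\otimes x)$ denotes the linear functional $(T_1,\ldots,T_d)\mapsto\sum_{i=1}^d\alpha_i x^*(T_ix)$ on $\mathcal{L}(\mathcal{X})^d$. *)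

(* Defs.v *)
From HB Require Import structures.
From mathcomp Require Import all_boot all_order all_algebra.
From mathcomp Require Import complex.
From mathcomp Require Import all_classical all_reals all_analysis.

Set Implicit Arguments.
Unset Strict Implicit.
Unset Printing Implicit Defensive.

Import Order.TTheory GRing.Theory Num.Theory.
Import numFieldNormedType.Exports.

Local Open Scope classical_set_scope.
Local Open Scope ring_scope.

Variant scalar_kind := RealScalars | ComplexScalars.

Definition scalars (R : realType) (k : scalar_kind) : numFieldType :=
  match k with RealScalars => R | ComplexScalars => R[i]%C end.

Definition re_part (R : realType) (k : scalar_kind) : scalars R k -> R :=
  match k with RealScalars => fun z => z | ComplexScalars => @complex.Re R end.

Definition of_real (R : realType) (k : scalar_kind) : R -> scalars R k :=
  match k with RealScalars => fun r => r | ComplexScalars => @real_complex R end.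

Section Scalars.
Context (R : realType) (k : scalar_kind).
Local Notation K := (scalars R k).

Lemma re_partD (a b : K) : re_part (a + b) = re_part a + re_part b.
Proof. by case: k a b => //= -[a a'] [b b']. Qed.

Lemma re_part_le (a b : K) : a <= b -> re_part a <= re_part b.
Proof. by case: k a b => //= -[a a'] [b b']; rewrite lecE => /andP[]. Qed.

Lemma re_partM_real (a b : K) : 0 <= a -> re_part (a * b) = re_part a * re_part b.
Proof.
case: k a b => //= -[a a'] [b b']; rewrite lecE /= => /andP[/eqP -> _].
by rewrite mul0r subr0.
Qed.

Lemma re_part_ge0 (a : K) : 0 <= a -> 0 <= re_part a.
Proof. by move=> /re_part_le; case: k a. Qed.

(* The library norm of a normedModType takes its values in the scalar field,
   as a nonnegative (hence real) element; [nrm] is that value in R. *)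
Definition nrm (V : normedModType K) (v : V) : R := re_part `|v|.

Lemma nrm0 (V : normedModType K) : nrm (0 : V) = 0.
Proof. by rewrite /nrm normr0; case: k. Qed.

Lemma nrmD (V : normedModType K) (u v : V) : nrm (u + v) <= nrm u + nrm v.
Proof. by rewrite /nrm -re_partD; apply/re_part_le/ler_normD. Qed.

Lemma nrmZ (V : normedModType K) (a : K) (v : V) :
  nrm (a *: v) = nrm (a : K^o) * nrm v.
Proof. by rewrite /nrm normrZ re_partM_real. Qed.

End Scalars.

(* Normed spaces other than the ground space X (operators, duals, biduals,
   tuples of operators) are given by an lmodType E together with a norm
   N : E -> R. *)
Section BoundedLinearMaps.
Context (R : realType) (k : scalar_kind).
Local Notation K := (scalars R k).
Context (E : lmodType K) (N : E -> R) (F : normedModType K).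

Definition bounded_linear_map : {pred (E -> F)} :=
  fun f => `[< linear f /\ exists M : R, forall x, nrm (f x) <= M * N x >].

Fact bounded_linear_map_submod : submod_closed bounded_linear_map.
Proof.
split=> [|a f g].
- apply/asboolP; split=> [b u v|]; first by rewrite /= scaler0 addr0.
  by exists 0 => x; rewrite mul0r nrm0.
- move=> /asboolP[lf [M Mf]] /asboolP[lg [M' Mg]]; apply/asboolP; split.
    move=> b u v; change (a *: f (b *: u + v) + g (b *: u + v) =
      b *: (a *: f u + g u) + (a *: f v + g v)).
    by rewrite lf lg !scalerDr !scalerA (mulrC a b) addrACA.
  exists (nrm (a : K^o) * M + M') => x; rewrite mulrDl -mulrA.
  apply: le_trans (nrmD _ _) _; apply: lerD; last exact: Mg.
  change (nrm (a *: f x) <= nrm (a : K^o) * (M * N x)).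
  by rewrite nrmZ ler_wpM2l ?Mf// re_part_ge0.
Qed.

HB.instance Definition _ := GRing.isSubmodClosed.Build K (E -> F)
  bounded_linear_map bounded_linear_map_submod.

Record blin := Blin {
  blin_fun :> E -> F;
  blin_prop : blin_fun \in bounded_linear_map }.

HB.instance Definition _ := [isSub for blin_fun].
HB.instance Definition _ := [Choice of blin by <:].
HB.instance Definition _ := [SubChoice_isSubLmodule of blin by <:].

Definition opnorm (f : blin) : R := sup [set nrm (f x) | x in [set x | N x <= 1]].

End BoundedLinearMaps.

Section NormedSpaces.
Context (R : realType) (k : scalar_kind).
Local Notation K := (scalars R k).

Definition is_norm (E : lmodType K) (N : E -> R) : Prop :=
  [/\ forall x, 0 <= N x,
      forall x, N x = 0 -> x = 0,
      forall (a : K) x, N (a *: x) = nrm (a : K^o) * N x &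
      forall x y, N (x + y) <= N x + N y].

Context (E : lmodType K) (N : E -> R).

Definition unit_ball : set E := [set x | N x <= 1].

Definition unit_sphere : set E := [set x | N x = 1].

(* For k = ComplexScalars, 0 < t < 1 in the partial order of R[i] means that t
   is a real number of the open unit interval. *)
Definition extreme_points : set E := [set x | unit_ball x /\
  forall (y z : E) (t : K), unit_ball y -> unit_ball z -> 0 < t < 1 ->
    x = t *: y + (1 - t) *: z -> y = x /\ z = x].

Definition dual : lmodType K := blin N (K^o : normedModType K).

Definition dual_norm : dual -> R := @opnorm R k E N (K^o : normedModType K).

Definition norming (y : E) : set dual :=
  [set f | dual_norm f = 1 /\ f y = of_real k (N y)].

Definition smooth (y : E) : Prop := y <> 0 /\ exists f, norming y = [set f].

Definition subspace (V : set E) : Prop :=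
  V 0 /\ forall (a : K) u v, V u -> V v -> V (a *: u + v).

(* codimension one: E is the direct sum of V and a line *)
Definition hyperspace (V : set E) : Prop :=
  subspace V /\
  exists2 v, ~ V v & forall y, exists c : K, V (y - c *: v).

Definition hyperplane (H : set E) : Prop :=
  exists (a : E) (V : set E), hyperspace V /\ H = [set a + v | v in V].

Definition exposed_point (x : E) : Prop :=
  unit_sphere x /\ exists2 H, hyperplane H & unit_sphere `&` H = [set x].

Definition finite_dimensional : Prop :=
  exists (n : nat) (e : 'I_n -> E),
    forall x, exists c : 'I_n -> K, x = \sum_(i < n) c i *: e i.

End NormedSpaces.

Section NumericalRadius.
Context (R : realType) (k : scalar_kind).
Local Notation K := (scalars R k).
Context (X : completeNormedModType K).
Local Notation normX := (@nrm R k X).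

Definition operators : lmodType K := blin normX X.

Definition dual_space : lmodType K := dual normX.

Definition dual_space_norm : dual_space -> R := @dual_norm R k X normX.

Definition Pi_set : set (X * dual_space) := [set u |
  [/\ unit_sphere normX u.1, unit_sphere dual_space_norm u.2 & u.2 u.1 = 1]].

Definition numerical_radius (T : operators) : R :=
  sup [set nrm (u.2 (T u.1)) | u in Pi_set].

(* L(X)^d, with the pointwise vector space structure *)
Definition operator_tuples (d : nat) : lmodType K := 'I_d -> operators.

Definition lp_norm (p : R) (d : nat) (a : 'I_d -> K) : R :=
  (\sum_(i < d) nrm (a i : K^o) `^ p) `^ p^-1.

Definition joint_numerical_radius (p : R) (d : nat) (T : operator_tuples d) : R :=
  sup [set lp_norm p (fun i => u.2 (T i u.1) : K) | u in Pi_set].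

Definition tensor_functional (d : nat) (a : 'I_d -> K) (xs : dual_space) (x : X)
  : operator_tuples d -> K^o := fun T => \sum_(i < d) a i * xs (T i x).

End NumericalRadius.

(* Main.v *)
Require Import Defs.
From HB Require Import structures.
From mathcomp Require Import all_boot all_order all_algebra.
From mathcomp Require Import complex ring lra.
From mathcomp Require Import all_classical all_reals all_analysis.

Set Implicit Arguments.
Unset Strict Implicit.
Unset Printing Implicit Defensive.

Import Order.TTheory GRing.Theory Num.Theory.
Import numFieldNormedType.Exports.

Local Open Scope classical_set_scope.
Local Open Scope ring_scope.

(** Write [G = tensor_functional alpha xs x] as a proper convex combination
    [t *: g + (1 - t) *: h] in the dual ball; the claim is [g = h = G].

    Reduction to a single operator.  Let [c] be the unit vector of l_p^d that
    norms [alpha].  On the tuple [(c_i I)] the functional [G] takes the value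
    [1], hence so do [g] and [h] ([eq1_of_convex]).  The l_p norm is smooth at
    [c] with derivative [alpha], uniformly on bounded sets ([lp_norm_smooth]),
    so comparing [g] with the joint numerical radius at [(c_i I) + h *: S] for
    small [h] bounds [Re g S] by the supremum of [Re ys ((sum alpha_i S_i) y)]
    over Pi ([dual_ball_re_le]).  Therefore [g S] depends only on the operator
    [sum alpha_i S_i] ([dual_ball_factor]), and through it [g] induces a state
    of L(X): a linear form whose real part is dominated by the upper bound of
    the numerical range.

    Uniqueness for states.  It remains to see that if [T |-> xs (T x)] is a
    proper convex combination of two states, then both are equal to it.
    Extremality of [xs] determines a state on the operators [xs (.) u], and
    extremality of [x] determines it on the operators [f (.) x]
    ([state_rank_one_functional], [state_rank_one_vector]); one of these two
    families is enough, provided the states vanish on a complementary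
    subspace.  For that, take [f] with [|f| <= 1 = f x] and put
    [A = f (.) x - I].  Both states kill [A], and [Re ys (A y) <= 0] on Pi with
    equality only if [|f y| = |ys x| = 1].  As Pi is compact
    ([Pi_ultra_limit]), [T + M A] has numerical range almost in the left half
    plane for large [M] whenever [ys (T y)] vanishes on that equality set
    ([penalty]); so a state that kills [A] kills [T] ([state_face]).

    Smoothness or exposedness serves to identify the equality set.  If [x] is
    exposed, its exposing functional as [f] forces [y] to be a multiple of [x];
    if [xs] is smooth, [f = xs] forces evaluation at [y] to be a multiple of
    evaluation at [x]; in both cases [ys (T y) = 0] as soon as [T x = 0].  If
    [x] is smooth, [f = xs] forces [ys] to be a multiple of [xs], and
    [ys (T y) = 0] as soon as [xs] vanishes on the range of [T].

    The Hahn-Banach theorem enters twice: it yields finitely many bounded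
    functionals and vectors with [z = sum e_i(z) u_i], which is all that is used
    of the finite dimension, and it recovers the norm of a vector from the dual
    ball. *)

(** * Linear maps and scalars *)

Section LinearMaps.
Context (A : pzRingType) (E F : lmodType A).
Implicit Types (f : E -> F) (u v : E).

Lemma linear_map0 f : linear f -> f 0 = 0.
Proof.
move=> lf; have := lf 1 0 0; rewrite !scale1r addr0 => /eqP.
by rewrite -subr_eq0 opprD addNKr oppr_eq0 => /eqP.
Qed.

Lemma linear_mapD f u v : linear f -> f (u + v) = f u + f v.
Proof. by move=> lf; have := lf 1 u v; rewrite !scale1r. Qed.

Lemma linear_mapZ f (a : A) u : linear f -> f (a *: u) = a *: f u.
Proof. by move=> lf; have := lf a u 0; rewrite !addr0 linear_map0// addr0. Qed.

End LinearMaps.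

Lemma linear_formZ (A : pzRingType) (E : lmodType A) (f : E -> A^o) (a : A) u :
  linear f -> f (a *: u) = a * f u.
Proof. exact: linear_mapZ. Qed.

Section ScalarTheory.
Context (R : realType) (k : scalar_kind).
Local Notation K := (scalars R k).
Implicit Types (a b c : K) (r s : R).

Lemma of_realD r s : of_real k (r + s) = of_real k r + of_real k s.
Proof. by case: k => //=; exact: raddfD. Qed.

Lemma of_realM r s : of_real k (r * s) = of_real k r * of_real k s.
Proof. by case: k => //=; exact: rmorphM. Qed.

Lemma of_real0 : of_real k (0 : R) = 0.
Proof. by case: k. Qed.

Lemma of_real1 : of_real k (1 : R) = 1.
Proof. by case: k. Qed.

Lemma of_realN r : of_real k (- r) = - of_real k r.
Proof. by case: k => //=; exact: raddfN. Qed.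

Lemma re_of_real r : re_part (of_real k r) = r.
Proof. by case: k. Qed.

Lemma re_of_realM r a : re_part (of_real k r * a) = r * re_part a.
Proof. by case: k a => //= -[x y] /=; rewrite mul0r subr0. Qed.

Lemma of_real_ge0 r : (0 <= of_real k r) = (0 <= r).
Proof. by case: k => //=; rewrite lecE /= eqxx. Qed.

Lemma of_real_gt0 r : (0 < of_real k r) = (0 < r).
Proof. by case: k => //=; rewrite ltcE /= eqxx. Qed.

Lemma of_real_re a : 0 <= a -> of_real k (re_part a) = a.
Proof. by case: k a => //= -[x y]; rewrite lecE /= => /andP[/eqP -> _]. Qed.

Lemma re_part0 : re_part (0 : K) = 0.
Proof. by case: k. Qed.

Lemma re_part1 : re_part (1 : K) = 1.
Proof. by case: k. Qed.

Lemma re_partN a : re_part (- a) = - re_part a.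
Proof. by case: k a => //= -[]. Qed.

Lemma re_partB a b : re_part (a - b) = re_part a - re_part b.
Proof. by rewrite re_partD re_partN. Qed.

Lemma re_part_sum (I : Type) (s : seq I) (F : I -> K) :
  re_part (\sum_(i <- s) F i) = \sum_(i <- s) re_part (F i).
Proof. by exact: (big_morph _ (@re_partD R k) re_part0). Qed.

Lemma norm_nrm a : `|a| = of_real k (nrm (a : K^o)).
Proof. by rewrite /nrm of_real_re. Qed.

Lemma nrm_scalarM a b : nrm (a * b : K^o) = nrm (a : K^o) * nrm (b : K^o).
Proof. exact: (nrmZ (V := K^o)). Qed.

Lemma nrm_ge0 (V : normedModType K) (v : V) : 0 <= nrm v.
Proof. exact: re_part_ge0. Qed.

Lemma nrm1 : nrm (1 : K^o) = 1.
Proof. by rewrite /nrm normr1 re_part1. Qed.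

Lemma nrmN (V : normedModType K) (v : V) : nrm (- v) = nrm v.
Proof. by rewrite /nrm normrN. Qed.

Lemma nrm_eq0 (V : normedModType K) (v : V) : nrm v = 0 -> v = 0.
Proof.
move=> h; apply/normr0_eq0.
by rewrite -[LHS]of_real_re// -/(nrm v) h of_real0.
Qed.

Lemma nrm_gt0 (V : normedModType K) (v : V) : v != 0 -> 0 < nrm v.
Proof.
by move=> v0; rewrite lt_def nrm_ge0 andbT; apply: contraNneq v0 => /nrm_eq0/eqP.
Qed.

Lemma nrm1_neq0 a : nrm (a : K^o) = 1 -> a != 0.
Proof. by apply: contra_eq_neq => ->; rewrite nrm0 eq_sym oner_neq0. Qed.

Lemma of_real_neq0 r : r != 0 -> of_real k r != 0.
Proof. by apply: contraNneq => r0; rewrite -(re_of_real r) r0 re_part0. Qed.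

Lemma of_realV r : of_real k r^-1 = (of_real k r)^-1.
Proof.
have [->|r0] := eqVneq r 0; first by rewrite invr0 of_real0 invr0.
by apply: (mulfI (of_real_neq0 r0)); rewrite divff ?of_real_neq0//
  -of_realM divff// of_real1.
Qed.

Lemma nrm_of_real r : 0 <= r -> nrm (of_real k r : K^o) = r.
Proof. by move=> r0; rewrite /nrm ger0_norm ?of_real_ge0// re_of_real. Qed.

Lemma nrmV a : nrm (a^-1 : K^o) = (nrm (a : K^o))^-1.
Proof.
have [->|a0] := eqVneq a 0; first by rewrite invr0 nrm0 invr0.
have n0 : nrm (a : K^o) != 0 by rewrite gt_eqF// nrm_gt0.
by apply: (mulfI n0); rewrite divff// -nrm_scalarM divff// nrm1.
Qed.

Lemma re_part_le_nrm a : re_part a <= nrm (a : K^o).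
Proof.
rewrite /nrm; case: k a => /= [x|[x y]]; first exact: ler_norm.
apply: le_trans (ler_norm _) _; rewrite -sqrtr_sqr ler_sqrt ?lerDl ?sqr_ge0//.
by rewrite addr_ge0 ?sqr_ge0.
Qed.

Lemma nrm_lerB (V : normedModType K) (u v : V) : nrm u - nrm v <= nrm (u - v).
Proof. by rewrite lerBlDr (le_trans _ (nrmD _ _))// subrK. Qed.

(** Strict convexity of the disc at [1]: the imaginary part has no room left. *)
Lemma eq1_of_re a : nrm (a : K^o) <= 1 -> re_part a = 1 -> a = 1.
Proof.
move=> a1; have : nrm (a : K^o) ^+ 2 <= 1 by rewrite expr_le1// nrm_ge0.
rewrite /nrm; case: k a {a1} => /= [x _ //|[x y]] /= h e.
move: h; rewrite sqr_sqrtr ?addr_ge0 ?sqr_ge0// e expr1n -[leRHS]addr0 lerD2l.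
by rewrite le_eqVlt ltNge sqr_ge0 orbF sqrf_eq0 => /eqP ->.
Qed.

(** Turns bounds on real parts, valid for all multiples of an argument, into
    bounds on absolute values. *)
Lemma rotation a : exists u : K, nrm (u : K^o) = 1 /\ u * a = of_real k (nrm (a : K^o)).
Proof.
have [->|a0] := eqVneq a 0.
  by exists 1; rewrite nrm1 mulr0 nrm0 of_real0.
exists (of_real k (nrm (a : K^o)) / a); split; last by rewrite mulfVK.
by rewrite nrm_scalarM nrm_of_real ?nrm_ge0// nrmV divff// gt_eqF// nrm_gt0.
Qed.

(** The number [1] is an extreme point of the unit disc. *)
Lemma eq1_of_convex (t a b : K) : 0 < t < 1 ->
  nrm (a : K^o) <= 1 -> nrm (b : K^o) <= 1 -> t * a + (1 - t) * b = 1 -> a = 1.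
Proof.
move=> /andP[t0 t1] a1 b1 e; apply: eq1_of_re => //.
have t'0 : 0 < 1 - t by rewrite subr_gt0.
have := congr1 (@re_part R k) e.
rewrite re_partD !re_partM_real ?ltW// re_partB re_part1.
set s := re_part t => E.
have s0 : 0 < s by rewrite -of_real_gt0 of_real_re// ltW.
have s1 : 0 < 1 - s.
  by rewrite -of_real_gt0 of_realD of_realN of_real1 of_real_re// ltW.
have := le_trans (re_part_le_nrm a) a1.
have := le_trans (re_part_le_nrm b) b1.
nra.
Qed.

End ScalarTheory.

(** * Bounded linear maps and their norms *)

Section BoundedLinearTheory.
Context (R : realType) (k : scalar_kind).
Local Notation K := (scalars R k).
Context (E : lmodType K) (N : E -> R) (F : normedModType K).
Implicit Types (f g : blin N F) (u v : E) (a : K).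

Lemma blinP f : linear f.
Proof. by case: f => f /= /asboolP[]. Qed.

Lemma blin0 f : f 0 = 0.
Proof. exact: linear_map0 (blinP f). Qed.

Lemma blinD f u v : f (u + v) = f u + f v.
Proof. exact: linear_mapD (blinP f). Qed.

Lemma blinZ f a u : f (a *: u) = a *: f u.
Proof. exact: linear_mapZ (blinP f). Qed.

Lemma blinB f u v : f (u - v) = f u - f v.
Proof. by rewrite blinD -(scaleN1r v) blinZ scaleN1r. Qed.

Lemma blin_sum f (I : Type) (s : seq I) (G : I -> E) :
  f (\sum_(i <- s) G i) = \sum_(i <- s) f (G i).
Proof. exact: (big_morph _ (blinD f) (blin0 f)). Qed.

Lemma blin_eq f g : f =1 g -> f = g.
Proof. by move=> h; apply: val_inj; apply: funext. Qed.

Lemma blin_addE f g u : (f + g) u = f u + g u.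
Proof. by []. Qed.

Lemma blin_scaleE a f u : (a *: f) u = a *: f u.
Proof. by []. Qed.

Lemma blin_oppE f u : (- f) u = - f u.
Proof. by []. Qed.

Lemma bounded_linear_mapI (h : E -> F) (M : R) : linear h ->
  (forall u, nrm (h u) <= M * N u) -> h \in @bounded_linear_map R k E N F.
Proof. by move=> lh Mh; apply/asboolP; split=> //; exists M. Qed.

Definition homogeneous :=
  (forall u, 0 <= N u) /\ (forall a u, N (a *: u) = nrm (a : K^o) * N u).

Hypothesis Nhom : homogeneous.

Lemma blin_bound f : exists M, 0 <= M /\ forall u, nrm (f u) <= M * N u.
Proof.
case: f => f /= /asboolP[_ [M Mf]]; exists `|M|; split=> // u.
by apply: le_trans (Mf u) _; rewrite ler_wpM2r ?ler_norm//; case: Nhom.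
Qed.

Lemma homogeneous0 : N 0 = 0.
Proof. by case: Nhom => _ h; rewrite -(scale0r (0 : E)) h nrm0 mul0r. Qed.

Lemma opnorm_le f c : (forall u, N u <= 1 -> nrm (f u) <= c) -> opnorm f <= c.
Proof.
move=> h; apply: ge_sup; first by exists (nrm (f 0)), 0; rewrite //= homogeneous0.
by move=> _ [u /= u1 <-]; exact: h.
Qed.

Lemma nrm_le_opnorm_ball f u : N u <= 1 -> nrm (f u) <= opnorm f.
Proof.
move=> u1; apply: ub_le_sup; last by exists u.
have [M [M0 Mf]] := blin_bound f; exists M => _ [v /= v1 <-].
by apply: le_trans (Mf v) _; rewrite -[leRHS]mulr1 ler_wpM2l.
Qed.

Lemma opnorm_ge0 f : 0 <= opnorm f.
Proof.
apply: le_trans (nrm_ge0 (f 0)) _.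
by apply: nrm_le_opnorm_ball; rewrite homogeneous0.
Qed.

Lemma nrm_le_opnorm f u : nrm (f u) <= opnorm f * N u.
Proof.
have [N0 NZ] := Nhom.
have [u0|u0] := eqVneq (N u) 0.
  have [M [_ /(_ u)]] := blin_bound f.
  by rewrite u0 !mulr0.
have ugt0 : 0 < N u by rewrite lt_def u0 N0.
have eqn : nrm (of_real k (N u)^-1 : K^o) = (N u)^-1.
  by rewrite nrm_of_real// invr_ge0 ltW.
rewrite -ler_pdivrMr// mulrC -eqn -nrmZ -blinZ.
by apply: nrm_le_opnorm_ball; rewrite NZ eqn mulVf.
Qed.

Lemma opnorm_homogeneous : (forall f, 0 <= opnorm f) /\
  (forall a f, opnorm (a *: f) = nrm (a : K^o) * opnorm f).
Proof.
have le a f : opnorm (a *: f) <= nrm (a : K^o) * opnorm f.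
  apply: opnorm_le => u u1; rewrite blin_scaleE nrmZ ler_wpM2l ?nrm_ge0//.
  exact: nrm_le_opnorm_ball.
split=> [|a f]; first exact: opnorm_ge0.
apply/eqP; rewrite eq_le le /=; have [->|a0] := eqVneq a 0.
  by rewrite nrm0 mul0r opnorm_ge0.
have n0 : 0 < nrm (a : K^o) by exact: nrm_gt0.
rewrite mulrC -ler_pdivlMr// mulrC -nrmV.
by have := le a^-1 (a *: f); rewrite scalerA mulVf// scale1r.
Qed.

End BoundedLinearTheory.

Section GroundSpace.
Context (R : realType) (k : scalar_kind).
Local Notation K := (scalars R k).
Context (X : completeNormedModType K).
Local Notation normX := (@nrm R k X).
Local Notation Xd := (dual_space X).
Local Notation L := (operators X).
Local Notation Pi := (@Pi_set R k X).

Lemma nrm_homogeneous : homogeneous normX.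
Proof. by split; [exact: nrm_ge0|exact: nrmZ]. Qed.

Lemma dual_homogeneous : homogeneous (@dual_space_norm R k X).
Proof. exact: opnorm_homogeneous nrm_homogeneous. Qed.

Lemma nrm_le_dual (f : Xd) u : nrm (f u) <= dual_space_norm f * normX u.
Proof. exact: nrm_le_opnorm nrm_homogeneous _ _. Qed.

Lemma nrm_le_of_dual_ball (f : Xd) u : dual_space_norm f <= 1 ->
  nrm (f u) <= normX u.
Proof.
move=> f1; apply: le_trans (nrm_le_dual f u) _.
by rewrite -[leRHS]mul1r ler_wpM2r ?nrm_ge0.
Qed.

Lemma dual_ballP (f : Xd) : (forall u, nrm (f u) <= normX u) ->
  dual_space_norm f <= 1.
Proof.
move=> h; apply: (opnorm_le nrm_homogeneous) => u u1.
exact: le_trans (h u) u1.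
Qed.

Fact rank_one_proof (f : Xd) (u : X) :
  (fun z => (f z : K) *: u) \in @bounded_linear_map R k X normX X.
Proof.
apply: (@bounded_linear_mapI _ _ _ _ _ _ (dual_space_norm f * normX u)).
  by move=> a v w /=; rewrite blinP scalerDl scalerA.
move=> v; rewrite nrmZ mulrAC ler_wpM2r ?nrm_ge0//.
exact: nrm_le_dual.
Qed.
Definition rank_one (f : Xd) (u : X) : L := Blin (rank_one_proof f u).

Fact id_operator_proof : (fun z : X => z) \in @bounded_linear_map R k X normX X.
Proof.
by apply: (@bounded_linear_mapI _ _ _ _ _ _ 1) => // u; rewrite mul1r.
Qed.
Definition id_operator : L := Blin id_operator_proof.

Fact comp_dual_proof (f : Xd) (T : L) :
  ((fun z => f (T z)) : X -> (K^o : normedModType K)) \in @bounded_linear_map R k X normX K^o.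
Proof.
have [M [M0 MT]] := blin_bound nrm_homogeneous T.
apply: (@bounded_linear_mapI _ _ _ _ _ _ (dual_space_norm f * M)).
  by move=> a u v /=; rewrite !blinP.
move=> u; apply: le_trans (nrm_le_dual _ _) _.
by rewrite -mulrA ler_wpM2l// (opnorm_ge0 nrm_homogeneous _).
Qed.
Definition comp_dual (f : Xd) (T : L) : Xd := Blin (comp_dual_proof f T).

Fact comp_operator_proof (S T : L) :
  (fun z => S (T z)) \in @bounded_linear_map R k X normX X.
Proof.
have [M [M0 MT]] := blin_bound nrm_homogeneous T.
have [M' [M'0 MS]] := blin_bound nrm_homogeneous S.
apply: (@bounded_linear_mapI _ _ _ _ _ _ (M' * M)).
  by move=> a u v /=; rewrite !blinP.
move=> u; apply: le_trans (MS _) _.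
by rewrite -mulrA ler_wpM2l.
Qed.
Definition comp_operator (S T : L) : L := Blin (comp_operator_proof S T).

Lemma Pi_le u (uPi : Pi u) (z : X) : nrm (u.2 z) <= normX z.
Proof. by case: uPi => _ h _; apply: nrm_le_of_dual_ball; rewrite h. Qed.

Lemma Pi_nrm u (uPi : Pi u) : normX u.1 = 1.
Proof. by case: uPi. Qed.

(** Both norms must be [1], because [1 = ys y] is at most their product. *)
Lemma PiI (y : X) (ys : Xd) : normX y <= 1 -> (forall z, nrm (ys z) <= normX z) ->
  ys y = 1 -> Pi (y, ys).
Proof.
move=> y1 ys1 e.
have e1 : 1 <= nrm (ys y) by rewrite e nrm1.
split=> //=; rewrite /unit_sphere/=; apply/eqP; rewrite eq_le.
  by rewrite y1 (le_trans e1).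
rewrite dual_ballP//= (le_trans e1)//.
exact: nrm_le_opnorm_ball nrm_homogeneous _ _ y1.
Qed.

End GroundSpace.

(** * The Hahn-Banach theorem *)

Section HahnBanach.
Context (R : realType) (k : scalar_kind).
Local Notation K := (scalars R k).
Context (V : lmodType K).
Local Notation "r ** u" := (of_real k r *: u) (at level 40).
Implicit Types (p q : V -> R) (u v : V) (r : R).

(** Homogeneity is stated as an inequality only: applied to [r] and its
    inverse it gives equality, and inequalities pass to infima. *)
Definition sublinear q := (forall u v, q (u + v) <= q u + q v) /\
  (forall r u, 0 < r -> q (r ** u) <= r * q u).

Lemma sublinear0 q : sublinear q -> q 0 = 0.
Proof.
move=> [qD qZ]; have := qD 0 0; rewrite addr0 => h.
have := qZ 2^-1 0; rewrite invr_gt0 ltr0n scaler0 => /(_ isT) h'.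
by lra.
Qed.

Lemma sublinear_lb q u : sublinear q -> - q (- u) <= q u.
Proof.
by move=> sq; have := sq.1 u (- u); rewrite subrr sublinear0//; lra.
Qed.

(** Common form of the two infima used below, over a chain and over a ray. *)
Lemma sublinear_inf (I : Type) (D : set I) (F : I -> V -> R) : D !=set0 ->
  (forall u, has_lbound [set F i u | i in D]) ->
  (forall i j u v, D i -> D j -> exists2 m, D m & F m (u + v) <= F i u + F j v) ->
  (forall i r u, D i -> 0 < r -> exists2 m, D m & F m (r ** u) <= r * F i u) ->
  sublinear (fun u => inf [set F i u | i in D]).
Proof.
move=> [i0 Di0] lbF FD FZ.
have infle m u : D m -> inf [set F i u | i in D] <= F m u.
  by move=> Dm; apply: ge_inf => //; exists m.
have leinf c u : (forall i, D i -> c <= F i u) -> c <= inf [set F i u | i in D].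
  move=> h; apply: lb_le_inf; first by exists (F i0 u), i0.
  by move=> _ [i Di <-]; exact: h.
split=> [u v|r u r0] /=.
  rewrite -lerBlDr; apply: (leinf _ u) => i Di; rewrite lerBlDr -lerBlDl.
  apply: (leinf _ v) => j Dj; rewrite lerBlDl.
  have [m Dm] := FD i j u v Di Dj; apply: le_trans; exact: infle.
rewrite mulrC -ler_pdivrMr//; apply: (leinf _ u) => i Di; rewrite ler_pdivrMr// mulrC.
by have [m Dm] := FZ i r u Di r0; apply: le_trans; exact: infle.
Qed.

(** The largest sublinear functional below [q] that takes the value [- q v]
    at [- v]. *)
Definition shifted q v u : R :=
  inf [set q (u + t ** v) - t * q v | t in [set t | 0 <= t]].

Lemma shifted_lbound q v u : sublinear q ->
  has_lbound [set q (u + t ** v) - t * q v | t in [set t | 0 <= t]].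
Proof.
move=> sq; exists (- q (- u)) => _ [t /= t0 <-].
have := sq.1 (u + t ** v) (- u); rewrite addrAC subrr add0r.
suff -> : q (t ** v) = t * q v by lra.
move: t0; rewrite le_eqVlt => /orP[/eqP <-|t0].
  by rewrite of_real0 scale0r mul0r sublinear0.
apply/eqP; rewrite eq_le sq.2//= mulrC -ler_pdivlMr//.
have := sq.2 t^-1 (t ** v); rewrite invr_gt0 scalerA -of_realM mulVf ?gt_eqF//.
by rewrite of_real1 scale1r mulrC; exact.
Qed.

Lemma shifted_sublinear q v : sublinear q -> sublinear (shifted q v).
Proof.
move=> sq; apply: sublinear_inf.
- by exists 0; rewrite /= lexx.
- by move=> u; exact: shifted_lbound.
- move=> s t u w /= s0 t0; exists (s + t); rewrite /= ?addr_ge0//.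
  have := sq.1 (u + s ** v) (w + t ** v).
  by rewrite addrACA -scalerDl -of_realD; lra.
- move=> t r u /= t0 r0; exists (r * t); rewrite /= ?mulr_ge0 ?(ltW r0)//.
  have := sq.2 r (u + t ** v) r0.
  by rewrite scalerDr scalerA -of_realM => h; rewrite mulrBr (mulrA r t) lerB.
Qed.

Lemma shifted_le q v u t : sublinear q -> 0 <= t ->
  shifted q v u <= q (u + t ** v) - t * q v.
Proof.
by move=> sq t0; apply: ge_inf; [exact: shifted_lbound|exists t].
Qed.

(** Zorn's lemma for the reversed pointwise order; a chain is bounded by its
    infimum, which is finite because [q u >= - q (- u) >= - p (- u)]. *)
Lemma minimal_sublinear p : sublinear p -> exists q, [/\ sublinear q,
  forall u, q u <= p u &
  forall q', sublinear q' -> (forall u, q' u <= q u) -> q' = q].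
Proof.
move=> sp; pose P q := sublinear q /\ forall u, q u <= p u.
pose T := {q | P q}.
pose rel (s t : T) : bool := `[< forall u, sval t u <= sval s u >].
have [|||A totA|[q [sq qp]] qmin] := @Zorn T rel.
- by move=> t; apply/asboolP.
- by move=> r s t /asboolP h1 /asboolP h2; apply/asboolP => u; apply: le_trans (h1 u).
- move=> [s hs] [t ht] /asboolP /= h1 /asboolP /= h2; apply: eq_exist.
  by apply: funext => u; apply/eqP; rewrite eq_le h1 h2.
- have [->|/set0P[t0 At0]] := eqVneq A set0.
    by exists (exist P p (conj sp (fun u => lexx _))) => s [].
  have lb u : has_lbound [set sval t u | t in A].
    exists (- p (- u)) => _ [[q [sq qp]] At /= <-].
    by rewrite (le_trans _ (sublinear_lb _ sq))// lerN2.
  have sm : sublinear (fun u => inf [set sval t u | t in A]).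
    apply: sublinear_inf => //; first by exists t0.
      move=> s t u v As At; have [/asboolP h|/asboolP h] := totA s t As At.
        exists t => //; apply: le_trans ((svalP t).1.1 _ _) _.
        by rewrite lerD2r.
      exists s => //; apply: le_trans ((svalP s).1.1 _ _) _.
      by rewrite lerD2l.
    by move=> s r u As r0; exists s => //; exact: (svalP s).1.2.
  have ml s u : A s -> inf [set sval t u | t in A] <= sval s u.
    by move=> As; apply: ge_inf => //; exists s.
  have mp u : inf [set sval t u | t in A] <= p u.
    by apply: le_trans (ml t0 u At0) _; exact: (svalP t0).2.
  by exists (exist P _ (conj sm mp)) => s As; apply/asboolP => u; exact: ml.
exists q; split=> // q' sq' q'q.
have q'p u : q' u <= p u by exact: le_trans (q'q u) (qp u).
suff /qmin/(congr1 sval) : rel (exist P q (conj sq qp)) (exist P q' (conj sq' q'p)) by [].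
exact/asboolP.
Qed.

(** A minimal sublinear functional [l] is additive, since [shifted l w] is
    below [l] and hence equal to it.  Starting the minimization at
    [shifted p v] instead of [p] forces [l v = p v]. *)
Lemma hahn_banach_real p v : sublinear p -> exists l : V -> R,
  [/\ forall u w, l (u + w) = l u + l w,
      forall r u, l (r ** u) = r * l u,
      forall u, l u <= p u & l v = p v].
Proof.
move=> sp.
have [l [sl lp lmin]] := minimal_sublinear (shifted_sublinear v sp).
have lD u w : l (u + w) = l u + l w.
  apply/eqP; rewrite eq_le sl.1/= -lerBrDr.
  rewrite -{1}(lmin _ (shifted_sublinear w sl)).
    by have := shifted_le w u sl ler01; rewrite of_real1 scale1r mul1r.
  move=> u'; have := shifted_le w u' sl (lexx 0).
  by rewrite of_real0 scale0r addr0 mul0r subr0.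
have l0 := sublinear0 sl.
have lN u : l (- u) = - l u.
  by apply/eqP; rewrite -subr_eq0 opprK -lD addNr l0.
have lZ r u : 0 < r -> l (r ** u) = r * l u.
  move=> r0; apply/eqP; rewrite eq_le sl.2//=.
  by have := sl.2 r (- u) r0; rewrite scalerN !lN mulrN lerN2.
have lp' u : l u <= p u.
  apply: le_trans (lp u) _; have := shifted_le v u sp (lexx 0).
  by rewrite of_real0 scale0r addr0 mul0r subr0.
exists l; split=> // [r u|].
  have [r0|r0|->] := ltgtP r 0; last 2 first.
  - exact: lZ.
  - by rewrite of_real0 scale0r mul0r l0.
  by have := lZ (- r) u; rewrite oppr_gt0 r0 of_realN scaleNr lN => /(_ isT); lra.
apply/eqP; rewrite eq_le lp'/=; have := lp (- v).
have := shifted_le v (- v) sp ler01.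
by rewrite of_real1 scale1r mul1r addNr sublinear0// lN; lra.
Qed.

End HahnBanach.

(** Over the complex numbers the functional is [l u - i l (i u)]. *)
Lemma complexification (R : realType) (k : scalar_kind)
  (V : lmodType (scalars R k)) (l : V -> R) :
  (forall u w, l (u + w) = l u + l w) ->
  (forall r u, l (of_real k r *: u) = r * l u) ->
  exists f : V -> (scalars R k)^o, linear f /\ forall u, re_part (f u) = l u.
Proof.
case: k V l => [|] /= V l lD lZ.
  by exists l; split=> // a u v; rewrite lD lZ.
exists (fun u => l u +i* (- l ('i%C *: u)))%C; split=> // a u v.
have lN u' : l (- u') = - l u'.
  by have := lZ (-1) u'; rewrite mulN1r rmorphN1 scaleN1r.
rewrite scalerDr !lD; case: a => a b.
have -> : (a +i* b)%C = (a%:C + 'i%C * b%:C)%C by rewrite {1}[(a +i* b)%C]complexE.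
rewrite scalerDl !scalerDr !scalerA.
have -> : ('i%C * ('i%C * b%:C) = - b%:C :> R[i])%C.
  by rewrite mulrA -expr2 sqr_i mulN1r.
rewrite ![('i * _%:C)%C]mulrC -!scalerA !lD scaleNr lN !lZ.
by apply/eqP; rewrite eq_complex /=; apply/andP; split; apply/eqP; simpc; rewrite /=; ring.
Qed.

Section NormingFunctional.
Context (R : realType) (k : scalar_kind).
Local Notation K := (scalars R k).
Context (X : completeNormedModType K).

Lemma norming_functional (v : X) : exists f : dual_space X,
  (forall u, nrm (f u) <= nrm u) /\ f v = of_real k (nrm v).
Proof.
have [|l [lD lZ ln lv]] := @hahn_banach_real R k X (@nrm R k X) v.
  split=> [|r u r0]; first exact: nrmD.
  by rewrite nrmZ nrm_of_real// ltW.
have [f [fl fre]] := complexification lD lZ.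
have fn u : nrm (f u) <= nrm u.
  have [a [a1 e]] := rotation (f u : K).
  have -> : nrm (f u) = l (a *: u).
    by rewrite -fre linear_formZ// e re_of_real.
  by rewrite (le_trans (ln _))// nrmZ a1 mul1r.
have fb : f \in @bounded_linear_map R k X (@nrm R k X) K^o.
  by apply: (@bounded_linear_mapI _ _ _ _ _ _ 1) => // u; rewrite mul1r.
exists (Blin fb); split=> //=.
have h : re_part (f v) = nrm v by rewrite fre.
have [->|v0] := eqVneq v 0.
  by rewrite nrm0 of_real0 linear_map0.
have nv0 := nrm_gt0 v0.
have c0 : of_real k (nrm v) != 0 by rewrite of_real_neq0// gt_eqF.
apply: (mulfI (invr_neq0 c0)); rewrite mulVf//; apply: eq1_of_re.
  by rewrite nrm_scalarM nrmV nrm_of_real ?nrm_ge0// mulrC ler_pdivrMr ?mul1r.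
by rewrite -of_realV re_of_realM h mulVf// gt_eqF.
Qed.

End NormingFunctional.

(** * Limits along ultrafilters and compactness of Pi *)

Section UltraLimits.
Context (R : realType) (k : scalar_kind).
Local Notation K := (scalars R k).
Context (T : Type) (U : set_system T) (UU : UltraFilter U).

Lemma real_ultra_cvg (b : T -> R) (M : R) :
  U [set t | `|b t| <= M] -> exists l : R, b @ U --> l.
Proof.
move=> bM.
have bUM : (b @ U) `[- M, M]%classic.
  suff : U (b @^-1` `[- M, M]%classic) by [].
  by apply: filterS bM => t /=; rewrite in_itv /= -ler_norml.
have [p [_ pcl]] := @segment_compact R (- M) M (b @ U) _ bUM.
exists p; apply/cvgrPdist_lt => e e0.
have [//|Ubad] := in_ultra_setVsetC [set t | `|p - b t| < e] UU.
have [|y [hy1]] := pcl [set y | ~ `|p - y| < e] (ball p e) Ubad.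
  exact: nbhsx_ballx.
by rewrite -ball_normE /= => /hy1.
Qed.

Lemma cvg_nrmP (b : T -> K) (l : K) : b @ U --> (l : K^o) <->
  forall e : R, 0 < e -> U [set t | nrm (l - b t : K^o) < e].
Proof.
have lt_nrm a e : (`|a| < of_real k e) = (nrm (a : K^o) < e).
  by rewrite norm_nrm -subr_gt0 -of_realN -of_realD of_real_gt0 subr_gt0.
split=> [/(@cvgrPdist_lt K K^o) h e e0|h].
  have := h (of_real k e); rewrite of_real_gt0 => /(_ e0).
  by apply: filterS => t /=; rewrite lt_nrm.
apply/(@cvgrPdist_lt K K^o) => e e0.
have eE : of_real k (re_part e) = e by rewrite of_real_re// ltW.
have := h (re_part e); rewrite -(of_real_gt0 k) eE => /(_ e0).
by apply: filterS => t /=; rewrite -lt_nrm eE.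
Qed.

Lemma bounded_ultra_cvg (b : T -> K) (M : R) :
  U [set t | nrm (b t : K^o) <= M] -> exists l : K, b @ U --> (l : K^o).
Proof.
move=> bM; suff [l bl] : exists l : K,
    forall e : R, 0 < e -> U [set t | nrm (l - b t : K^o) < e].
  by exists l; apply/cvg_nrmP.
move: bM; rewrite /nrm; case: k b => /= b bM.
  have [l /cvgrPdist_lt bl] := real_ultra_cvg bM.
  by exists l => e e0; exact: bl.
have [|x xl] := @real_ultra_cvg (fun t => complex.Re (b t)) M.
  apply: filterS bM => t /=; case: (b t) => c d /=; apply: le_trans.
  by rewrite -sqrtr_sqr ler_sqrt ?lerDl ?addr_ge0 ?sqr_ge0.
have [|y yl] := @real_ultra_cvg (fun t => complex.Im (b t)) M.
  apply: filterS bM => t /=; case: (b t) => c d /=; apply: le_trans.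
  by rewrite -sqrtr_sqr ler_sqrt ?lerDr ?addr_ge0 ?sqr_ge0.
exists (x +i* y)%C => e e0.
have e20 : 0 < e / 2 by rewrite divr_gt0.
move/cvgrPdist_lt/(_ _ e20): xl; move/cvgrPdist_lt/(_ _ e20): yl.
apply: filterS2 => t /=; case: (b t) => c d /= h1 h2.
rewrite -(ger0_norm (ltW e0)) -sqrtr_sqr ltr_sqrt ?exprn_gt0//.
move: h1 h2; rewrite !ltr_norml => /andP[? ?] /andP[? ?]; nra.
Qed.

Lemma ultra_cvg_re_le (b : T -> K) (l : K) (r : R) :
  b @ U --> (l : K^o) -> U [set t | re_part (b t) <= r] -> re_part l <= r.
Proof.
move=> /cvg_nrmP bl br; rewrite leNgt; apply/negP => rl.
have e0 : 0 < re_part l - r by rewrite subr_gt0.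
have [t [/= ht1 ht2]] := filter_ex (filterI (bl _ e0) br).
have := re_part_le_nrm (l - b t); rewrite re_partB.
by move: ht1 ht2; lra.
Qed.

Lemma ultra_cvg_nrm_le (b : T -> K) (l : K) (r : R) :
  b @ U --> (l : K^o) -> U [set t | nrm (b t : K^o) <= r] -> nrm (l : K^o) <= r.
Proof.
move=> bl br; have [w [w1 e]] := rotation l.
rewrite -(re_of_real k (nrm (l : K^o))) -e.
apply: (@ultra_cvg_re_le (fun t => w * b t)).
  exact: (@cvgMl_tmp K T U _ b w l bl).
apply: filterS br => t /=; apply: le_trans.
by apply: le_trans (re_part_le_nrm _) _; rewrite nrm_scalarM w1 mul1r.
Qed.

Lemma ultra_cvg_eq (b : T -> K) (l c : K) :
  b @ U --> (l : K^o) -> U [set t | b t = c] -> l = c.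
Proof.
move=> bl bc; apply/eqP; rewrite -subr_eq0; apply/eqP.
apply: (@nrm_eq0 R k K^o); apply/eqP; rewrite eq_le nrm_ge0 andbT.
apply: (@ultra_cvg_nrm_le (fun t => b t - c)).
  by apply: cvgB => //; exact: cvg_cst.
by apply: filterS bc => t /= ->; rewrite subrr nrm0.
Qed.

Lemma ultra_cvg_sum (I : Type) (s : seq I) (b : I -> T -> K) (l : I -> K) :
  (forall i, b i @ U --> (l i : K^o)) ->
  (fun t => \sum_(i <- s) b i t) @ U --> (\sum_(i <- s) l i : K^o).
Proof.
move=> bl; elim: s => [|i s IH].
  rewrite big_nil; under eq_fun do rewrite big_nil; exact: cvg_cst.
rewrite big_cons; under eq_fun do rewrite big_cons.
exact: (@cvgD _ K^o).
Qed.

End UltraLimits.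

Section DualSystem.
Context (R : realType) (k : scalar_kind).
Local Notation K := (scalars R k).
Context (X : completeNormedModType K).
Local Notation Xd := (dual_space X).
Local Notation L := (operators X).

(** Induction on the number of vectors spanning the range: if [g] is a bounded
    functional with [g u_0 = 1], composing [P] with [id - g (.) u_0] kills
    [u_0], so that the range is spanned by one vector less. *)
Lemma finite_rank_decomposition (m : nat) (P : L) (u : 'I_m -> X) :
  (forall z, exists c : 'I_m -> K, P z = \sum_i c i *: u i) ->
  exists s : seq (Xd * X), forall z, P z = \sum_(e <- s) (e.1 z : K) *: e.2.
Proof.
elim: m P u => [|m IH] P u Pu.
  exists [::] => z; have [c ->] := Pu z.
  by rewrite big_ord0 big_nil.
have [u0|u0] := eqVneq (u ord0) 0.
  apply: (IH P (fun i => u (lift ord0 i))) => z; have [c ->] := Pu z.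
  by exists (fun i => c (lift ord0 i)); rewrite big_ord_recl u0 scaler0 add0r.
have [f [_ fu]] := norming_functional (u ord0).
have fu0 : (f (u ord0) : K) != 0.
  by rewrite fu of_real_neq0// gt_eqF// nrm_gt0.
pose g : Xd := (f (u ord0) : K)^-1 *: f.
have gu : g (u ord0) = 1 by rewrite blin_scaleE /GRing.scale/= mulVf.
pose Q : L := id_operator X - rank_one g (u ord0).
have QE z : Q z = z - (g z : K) *: u ord0 by [].
have Q0 : Q (u ord0) = 0 by rewrite QE gu scale1r subrr.
have [|s Ps] := IH (comp_operator Q P) (fun i => Q (u (lift ord0 i))).
  move=> z; have [c Pz] := Pu z; exists (fun i => c (lift ord0 i)).
  rewrite -[comp_operator Q P z]/(Q (P z)) Pz blin_sum big_ord_recl blinZ Q0 scaler0 add0r.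
  by apply: eq_bigr => i _; rewrite blinZ.
exists ((comp_dual g P, u ord0) :: s) => z; rewrite big_cons -Ps.
by rewrite -[comp_operator Q P z]/(Q (P z)) QE /= addrC subrK.
Qed.

(** This gives bounded coordinates without choosing a basis and without
    comparing norms. *)
Lemma dual_system : finite_dimensional X -> exists s : seq (Xd * X),
  forall z, z = \sum_(e <- s) (e.1 z : K) *: e.2.
Proof.
move=> [n [e he]].
by have [|s hs] := @finite_rank_decomposition n (id_operator X) e; [|exists s].
Qed.

End DualSystem.

Section Compactness.
Context (R : realType) (k : scalar_kind).
Local Notation K := (scalars R k).
Context (X : completeNormedModType K).
Local Notation Xd := (dual_space X).
Local Notation L := (operators X).
Local Notation Pi := (@Pi_set R k X).

(** Compactness of Pi.  Every bounded scalar quantity has a limit along [U],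
    and finitely many of them, [f (v t).1] and [(v t).2 z], determine the
    pair [v t] through a dual system. *)
Lemma Pi_ultra_limit (T : Type) (U : set_system T) (v : T -> X * Xd) :
  finite_dimensional X -> UltraFilter U -> U [set t | Pi (v t)] ->
  exists2 u, Pi u & forall S : L,
    ((v t).2 (S (v t).1) : K) @[t --> U] --> (u.2 (S u.1) : K^o).
Proof.
move=> /dual_system[s Xs] UU UPi.
have /choice[A Acvg] : forall f : Xd, exists l : K,
    (f (v t).1 : K) @[t --> U] --> (l : K^o).
  move=> f; apply: (@bounded_ultra_cvg _ _ _ _ _ _ (dual_space_norm f)).
  apply: filterS UPi => t [t1 _ _].
  by apply: (nrm_le_opnorm_ball (@nrm_homogeneous R k X)); rewrite t1.
have /choice[B Bcvg] : forall z : X, exists l : K,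
    ((v t).2 z : K) @[t --> U] --> (l : K^o).
  move=> z; apply: (@bounded_ultra_cvg _ _ _ _ _ _ (nrm z)).
  by apply: filterS UPi => t tPi; apply: Pi_le.
pose y : X := \sum_(e <- s) A e.1 *: e.2.
pose ys : Xd := \sum_(e <- s) B e.2 *: e.1.
have ysE z : ys z = \sum_(e <- s) B e.2 * e.1 z :> K.
  rewrite /ys; elim: s {Xs y ys} => [|e s' IH]; first by rewrite !big_nil.
  by rewrite !big_cons blin_addE IH.
have fy (f : Xd) : f y = A f.
  have h : (fun t => f (v t).1 : K) =
      (fun t => \sum_(e <- s) (e.1 (v t).1 : K) * (f e.2 : K)).
    apply: funext => t; rewrite {1}(Xs (v t).1) blin_sum.
    by apply: eq_bigr => e _; rewrite blinZ.
  have := Acvg f; rewrite h => lim1.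
  have lim2 : (fun t => \sum_(e <- s) (e.1 (v t).1 : K) * (f e.2 : K)) @ U -->
      (f y : K^o).
    rewrite /y blin_sum; under eq_bigr do rewrite blinZ.
    apply: ultra_cvg_sum => e.
    exact: (@cvgMr_tmp K T U _ (fun t => e.1 (v t).1) (A e.1) (f e.2) (Acvg _)).
  exact: (@norm_cvg_unique _ K^o _ _ _ _ lim2 lim1).
have Bys z : B z = ys z.
  have h : (fun t => (v t).2 z : K) =
      (fun t => \sum_(e <- s) ((v t).2 e.2 : K) * (e.1 z : K)).
    apply: funext => t; rewrite {1}(Xs z) blin_sum.
    by apply: eq_bigr => e _; rewrite blinZ mulrC.
  have := Bcvg z; rewrite h => lim1.
  have lim2 : (fun t => \sum_(e <- s) ((v t).2 e.2 : K) * (e.1 z : K)) @ U -->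
      (ys z : K^o).
    rewrite ysE; apply: ultra_cvg_sum => e.
    exact: (@cvgMr_tmp K T U _ (fun t => (v t).2 e.2) (B e.2) (e.1 z) (Bcvg _)).
  exact: (@norm_cvg_unique _ K^o _ _ _ _ lim1 lim2).
have cvgS (S : L) : ((v t).2 (S (v t).1) : K) @[t --> U] --> (ys (S y) : K^o).
  have -> : (fun t => (v t).2 (S (v t).1) : K) =
     (fun t => \sum_(e <- s) ((v t).2 e.2 : K) * (comp_dual e.1 S (v t).1 : K)).
    apply: funext => t; rewrite {1}(Xs (S (v t).1)) blin_sum.
    by apply: eq_bigr => e _; rewrite blinZ mulrC.
  rewrite ysE; apply: ultra_cvg_sum => e.
  apply: (@cvgM K T U _ (fun t => (v t).2 e.2) (fun t => comp_dual e.1 S (v t).1)).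
    exact: Bcvg.
  by have := Acvg (comp_dual e.1 S); rewrite -fy.
exists (y, ys) => //; apply: PiI.
- have [f [f1 fye]] := norming_functional y.
  rewrite -(nrm_of_real k (nrm_ge0 y)) -fye fy.
  apply: (ultra_cvg_nrm_le UU (Acvg f)).
  by apply: filterS UPi => t [t1 _ _] /=; rewrite (le_trans (f1 _))// t1.
- move=> z; rewrite -Bys; apply: (ultra_cvg_nrm_le UU (Bcvg z)).
  by apply: filterS UPi => t tPi; apply: Pi_le.
- apply: (ultra_cvg_eq UU (cvgS (id_operator X))).
  by apply: filterS UPi => t [_ _] /=.
Qed.

End Compactness.

(** * Smoothness of the l_p norm *)

Section SmoothnessOfLp.
Context (R : realType) (k : scalar_kind).
Local Notation K := (scalars R k).
Context (p q : R).
Hypotheses (p_gt1 : 1 < p) (pq_conj : p^-1 + q^-1 = 1).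

Let p_gt0 : 0 < p. Proof. exact: lt_trans p_gt1. Qed.

Let q_gt0 : 0 < q.
Proof.
rewrite -invr_gt0; have : p^-1 < 1 by rewrite invf_lt1.
by move: pq_conj; lra.
Qed.

Let qVE : p * q^-1 = p - 1.
Proof.
have -> : q^-1 = 1 - p^-1 by rewrite -pq_conj addrC addKr.
by rewrite mulrBr mulr1 mulfV ?gt_eqF.
Qed.

Let mulqBp : (q - 1) * p = q.
Proof.
have h : q^-1 = 1 - p^-1 by rewrite -pq_conj addrC addKr.
have p0 : p != 0 by rewrite gt_eqF.
have q0 : q != 0 by rewrite gt_eqF.
have : p * q * (p^-1 + q^-1) = p * q by rewrite pq_conj mulr1.
have -> : p * q * (p^-1 + q^-1) = q + p by field; rewrite p0 q0.
by rewrite mulrBl mul1r mulrC => <-; rewrite addrK.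
Qed.

(** Young's inequality for the product [v * 1]. *)
Lemma powR_bernoulli (v : R) : 0 <= v -> p * v - (p - 1) <= v `^ p.
Proof.
move=> v0; have := conjugate_powR v0 (@ler01 R) p_gt0 q_gt0 pq_conj.
rewrite mulr1 powR1 div1r -(ler_pM2l p_gt0) mulrDr qVE mulrCA mulfV ?gt_eqF//.
by rewrite mulr1; lra.
Qed.

(** Second-order upper bound, obtained from the Bernoulli inequality at
    [(1 + u)^-1]. *)
Lemma powR_tangent (u : R) : p * `|u| <= 2^-1 ->
  (1 + u) `^ p <= 1 + p * u + 2 * p ^+ 2 * u ^+ 2.
Proof.
move=> hu; have u0 := normr_ge0 u.
have [ul uu] : - `|u| <= u /\ u <= `|u| by rewrite ler_norm lerNl -normrN ler_norm.
have uh : `|u| <= 2^-1 by apply: le_trans hu; rewrite ler_peMl// ltW.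
have u1 : 0 < 1 + u by lra.
have pu : (p - 1) * u <= 2^-1.
  have : (p - 1) * u <= (p - 1) * `|u| by rewrite ler_pM2l ?subr_gt0.
  by lra.
have D0 : 0 < 1 - (p - 1) * u by lra.
have := @powR_bernoulli (1 + u)^-1; rewrite invr_ge0 => /(_ (ltW u1)).
have -> : p * (1 + u)^-1 - (p - 1) = (1 - (p - 1) * u) / (1 + u).
  by field; rewrite gt_eqF.
have -> : (1 + u)^-1 `^ p = ((1 + u) `^ p)^-1.
  by rewrite -powR_inv1 ?(ltW u1)// powRAC powR_inv1 ?powR_ge0.
rewrite -[leLHS]invrK lef_pV2 ?posrE ?invr_gt0 ?divr_gt0 ?powR_gt0//.
move=> /le_trans; apply; rewrite invf_div ler_pdivrMr//.
have : 0 <= u ^+ 2 * (2 * p ^+ 2 - p * (p - 1) - 2 * p ^+ 2 * (p - 1) * u).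
  apply: mulr_ge0; first exact: sqr_ge0.
  have : p ^+ 2 * ((p - 1) * u) <= p ^+ 2 * 2^-1 by rewrite ler_wpM2l ?sqr_ge0.
  have := p_gt0.
  lra.
lra.
Qed.

Lemma nrm_sqrD1 (w : K) : nrm (1 + w : K^o) ^+ 2 = 1 + 2 * re_part w + nrm (w : K^o) ^+ 2.
Proof.
rewrite /nrm; case: k w => /= [x|[x y]] /=.
  by rewrite !real_normK ?num_real//; ring.
by rewrite !sqr_sqrtr ?addr_ge0 ?sqr_ge0//; ring.
Qed.

Lemma nrm1D_le (w : K) : nrm (w : K^o) <= 2^-1 ->
  nrm (1 + w : K^o) <= 1 + re_part w + nrm (w : K^o) ^+ 2.
Proof.
move=> w1; have := re_part_le_nrm (- w); rewrite re_partN nrmN.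
have := nrm_sqrD1 w; have := nrm_ge0 (1 + w : K^o); have := nrm_ge0 (w : K^o).
move: w1; set m := nrm (w : K^o); set x := re_part w; set n := nrm _.
move=> m1 m0 n0 e xm.
have s0 : 0 <= 1 + x + m ^+ 2 by nra.
rewrite -(ler_pXn2r (_ : (0 < 2)%N))// e.
have : 0 <= m ^+ 2 * (1 + 2 * x) by rewrite mulr_ge0 ?sqr_ge0//; lra.
have := sqr_ge0 x; have : 0 <= m ^+ 4 by rewrite exprn_even_ge0.
nra.
Qed.

(** Equal to [conj a * |a| ^ (q - 2)], and to [0] when [a = 0] since then
    [a^-1 = 0].  This form avoids the conjugation and makes
    [a * dual_scalar a = |a| ^ q] immediate. *)
Definition dual_scalar (a : K) : K := of_real k (nrm (a : K^o) `^ q) / a.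

Lemma mul_dual_scalar a : a * dual_scalar a = of_real k (nrm (a : K^o) `^ q).
Proof.
rewrite /dual_scalar mulrCA; have [->|a0] := eqVneq a 0; last by rewrite mulfV// mulr1.
by rewrite mul0r mulr0 nrm0 powR0 ?gt_eqF// of_real0.
Qed.

Lemma nrm_dual_scalar a : nrm (dual_scalar a : K^o) `^ p = nrm (a : K^o) `^ q.
Proof.
rewrite /dual_scalar nrm_scalarM nrm_of_real ?powR_ge0// nrmV.
have [->|a0] := eqVneq (nrm (a : K^o)) 0; first by rewrite invr0 mulr0 !powR0 ?gt_eqF.
rewrite -[X in _ * X]powR_inv1 ?nrm_ge0// -powRD; last by rewrite a0 implybT.
by rewrite -powRrM mulqBp.
Qed.

(** The derivative of [|.| ^ p] at [dual_scalar a] is [s |-> p Re (a s)], with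
    a remainder that is small uniformly for [|s| <= B].  For [a = 0] this is
    [|h s| ^ p = o(h)], which needs [1 < p]; for [a <> 0] it follows from the
    expansion at [1] after dividing by [dual_scalar a]. *)
Lemma powR_nrm_tangent (a : K) (B e : R) : 0 <= B -> 0 < e ->
  exists2 h0, 0 < h0 & forall h (s : K), 0 < h <= h0 -> nrm (s : K^o) <= B ->
    nrm (dual_scalar a + of_real k h * s : K^o) `^ p
      <= nrm (a : K^o) `^ q + p * h * re_part (a * s) + e * h.
Proof.
move=> B0 e0; have [->|a0] := eqVneq a 0.
  have Bp0 : 0 < B `^ p + 1 by rewrite ltr_wpDl ?powR_ge0.
  exists ((e / (B `^ p + 1)) `^ (p - 1)^-1); first by rewrite powR_gt0 ?divr_gt0.
  move=> h s /andP[h0 hh] sB; rewrite /dual_scalar invr0 mulr0 add0r mul0r re_part0.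
  rewrite nrm0 powR0 ?gt_eqF// mulr0 !add0r.
  rewrite nrm_scalarM nrm_of_real ?(ltW h0)//.
  rewrite powRM ?nrm_ge0 ?(ltW h0)// -(mulr_powRB1 (ltW h0) p_gt0).
  rewrite [e * h]mulrC -mulrA ler_wpM2l ?(ltW h0)//.
  have p10 : 0 < p - 1 by rewrite subr_gt0.
  have h1 : h `^ (p - 1) <= e / (B `^ p + 1).
    have := ge0_ler_powR (ltW p10) (_ : h \in Num.nneg) (_ : _ \in Num.nneg) hh.
    rewrite -powRrM mulVf ?gt_eqF// powRr1 ?divr_ge0 ?(ltW e0) ?(ltW Bp0)//; apply.
      by rewrite nnegrE ltW.
    by rewrite nnegrE powR_ge0.
  have h2 : nrm (s : K^o) `^ p <= B `^ p + 1.
    rewrite (@le_trans _ _ (B `^ p)) ?lerDl//.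
    by apply: (ge0_ler_powR (ltW p_gt0)); rewrite ?nnegrE ?nrm_ge0.
  apply: le_trans (ler_pM (powR_ge0 _ _) (powR_ge0 _ _) h1 h2) _.
  by rewrite divfK// gt_eqF.
pose A := nrm (a : K^o) `^ q.
have na0 : 0 < nrm (a : K^o) by exact: nrm_gt0.
have A0 : 0 < A by rewrite powR_gt0.
pose B' := nrm (a : K^o) * B / A.
have B'0 : 0 <= B' by rewrite divr_ge0 ?mulr_ge0 ?nrm_ge0 ?(ltW A0).
have E0 : 0 < 4 * p * (B' + 1) by rewrite !mulr_gt0// ltr_wpDl.
have F0 : 0 < 9 * p ^+ 2 * B' ^+ 2 * A + 1.
  apply: ltr_wpDl => //; apply: mulr_ge0; last exact: ltW.
  by apply: mulr_ge0; [apply: mulr_ge0 => //|]; exact: sqr_ge0.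
(* The first bound makes [p |u| <= 1/2] for the increment [u] below; the second
   one makes the quadratic remainder, at most 9 p^2 B'^2 A h^2, at most [e h]. *)
exists (Num.min (4 * p * (B' + 1))^-1 (e / (9 * p ^+ 2 * B' ^+ 2 * A + 1))).
  by rewrite lt_min invr_gt0 E0 divr_gt0.
move=> h s /andP[h0]; rewrite le_min => /andP[hE hF] sB.
have {}hE : h * (4 * p * (B' + 1)) <= 1 by rewrite -ler_pdivlMr// mul1r.
have {}hF : h * (9 * p ^+ 2 * B' ^+ 2 * A + 1) <= e by rewrite -ler_pdivlMr.
pose w : K := of_real k (h / A) * (a * s).
have A0' : of_real k A != 0 by rewrite of_real_neq0// gt_eqF.
have -> : dual_scalar a + of_real k h * s = dual_scalar a * (1 + w).
  rewrite mulrDr mulr1; congr (_ + _); rewrite /w /dual_scalar -/A.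
  by rewrite of_realM of_realV mulrACA mulKf// [_ * (_ / _)]mulrCA mulfV// mulr1.
have wre : re_part w = h / A * re_part (a * s) by rewrite re_of_realM.
have wn : nrm (w : K^o) <= h * B'.
  rewrite nrm_scalarM nrm_of_real ?divr_ge0 ?(ltW h0) ?(ltW A0)// nrm_scalarM /B'.
  rewrite mulrAC -mulrA; apply: ler_wpM2l; first exact: ltW.
  by rewrite ler_wpM2r ?invr_ge0 ?(ltW A0)// ler_wpM2l ?nrm_ge0.
have hB0 : 0 <= h * B' by rewrite mulr_ge0 ?(ltW h0).
have hB4 : 4 * p * (h * B') <= 1.
  apply: le_trans hE; rewrite mulrCA ler_wpM2l ?(ltW h0)//.
  by rewrite ler_wpM2l ?mulr_ge0 ?(ltW p_gt0)// lerDl.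
have hB : h * B' <= 4^-1.
  have : h * B' <= p * (h * B') by rewrite ler_peMl ?(ltW p_gt1).
  by lra.
have m0 := nrm_ge0 (w : K^o).
have [x1 x2] : - nrm (w : K^o) <= re_part w /\ re_part w <= nrm (w : K^o).
  split; last exact: re_part_le_nrm.
  by have := re_part_le_nrm (- w); rewrite re_partN nrmN lerNl.
set m := nrm (w : K^o) in wn m0 x1 x2 *.
have m12 : m <= 2^-1 by lra.
have w1 := nrm1D_le m12; rewrite -/m in w1.
set u := re_part w + m ^+ 2.
have un : `|u| <= 2 * (h * B').
  have : m ^+ 2 <= m by rewrite expr2 ler_piMl//; lra.
  have : 0 <= m ^+ 2 by exact: sqr_ge0.
  by rewrite ler_norml /u => ? ?; apply/andP; split; lra.
have pu : p * `|u| <= 2^-1.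
  have : p * `|u| <= p * (2 * (h * B')) by rewrite ler_pM2l.
  by lra.
rewrite nrm_scalarM powRM ?nrm_ge0// nrm_dual_scalar -/A.
have t1 : nrm (1 + w : K^o) `^ p <= 1 + p * u + 2 * p ^+ 2 * u ^+ 2.
  apply: le_trans (powR_tangent pu).
  apply: (ge0_ler_powR (ltW p_gt0)); rewrite ?nnegrE ?nrm_ge0//.
    by rewrite (le_trans _ (_ : nrm (1 + w : K^o) <= _)) ?nrm_ge0// /u addrA.
  by rewrite /u addrA.
have u2 : u ^+ 2 <= 4 * (h * B') ^+ 2.
  rewrite -[u ^+ 2]real_normK ?num_real//.
  have -> : 4 * (h * B') ^+ 2 = (2 * (h * B')) ^+ 2 by ring.
  by rewrite ler_pXn2r ?nnegrE// mulr_ge0// mulr_ge0 ?(ltW h0).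
have m2 : m ^+ 2 <= (h * B') ^+ 2.
  by rewrite ler_pXn2r ?nnegrE// mulr_ge0 ?(ltW h0).
have t2 : nrm (1 + w : K^o) `^ p <= 1 + p * re_part w + 9 * p ^+ 2 * (h * B') ^+ 2.
  apply: le_trans t1 _.
  have : p * m ^+ 2 <= p ^+ 2 * (h * B') ^+ 2.
    by apply: ler_pM; rewrite ?sqr_ge0 ?(ltW p_gt0)// expr2 ler_peMl ?(ltW p_gt0) ?(ltW p_gt1).
  have : p ^+ 2 * u ^+ 2 <= p ^+ 2 * (4 * (h * B') ^+ 2).
    by rewrite ler_wpM2l ?sqr_ge0.
  by rewrite /u; lra.
apply: le_trans (ler_wpM2l (ltW A0) t2) _.
have -> : A * (1 + p * re_part w + 9 * p ^+ 2 * (h * B') ^+ 2) =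
   A + p * h * re_part (a * s) + h * (9 * p ^+ 2 * B' ^+ 2 * A) * h.
  by rewrite wre; field; rewrite gt_eqF.
rewrite lerD2l ler_wpM2r ?(ltW h0)//; move: hF; rewrite mulrDr mulr1.
by lra.
Qed.

Section Tuples.
Context (d : nat).
Implicit Types (alpha s : 'I_d -> K).

Lemma lp_norm_ge0 r s : 0 <= lp_norm r s.
Proof. exact: powR_ge0. Qed.

Lemma lp_norm_powR s : lp_norm p s `^ p = \sum_(i < d) nrm (s i : K^o) `^ p.
Proof.
rewrite /lp_norm -powRrM mulVf ?gt_eqF// powRr1//.
by apply: sumr_ge0 => i _; exact: powR_ge0.
Qed.

(** Concavity of the root of order [p], again as Young's inequality with
    second factor [1]. *)
Lemma lp_norm_tangent s c :
  \sum_(i < d) nrm (s i : K^o) `^ p <= c -> lp_norm p s <= 1 + (c - 1) / p.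
Proof.
move=> sc.
have := conjugate_powR (lp_norm_ge0 p s) (@ler01 R) p_gt0 q_gt0 pq_conj.
rewrite mulr1 powR1 div1r lp_norm_powR => /le_trans; apply.
have -> : q^-1 = 1 - p^-1 by rewrite -pq_conj addrC addKr.
have : (\sum_(i < d) nrm (s i : K^o) `^ p) / p <= c / p.
  by rewrite ler_wpM2r// invr_ge0 ltW.
by rewrite mulrBl mul1r; lra.
Qed.

Lemma lp_norm_scale (a : K) s :
  lp_norm p (fun i => a * s i) = nrm (a : K^o) * lp_norm p s.
Proof.
rewrite /lp_norm; under eq_bigr do rewrite nrm_scalarM powRM ?nrm_ge0//.
rewrite -mulr_sumr powRM ?powR_ge0//; last by apply: sumr_ge0 => i _; exact: powR_ge0.
by rewrite -powRrM mulfV ?gt_eqF// powRr1 ?nrm_ge0.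
Qed.

Lemma lp_unit_sum alpha : lp_norm q alpha = 1 ->
  \sum_(i < d) nrm (alpha i : K^o) `^ q = 1.
Proof.
move=> /(congr1 (fun x => x `^ q)); rewrite powR1 /lp_norm -powRrM mulVf ?gt_eqF//.
by rewrite powRr1//; apply: sumr_ge0 => i _; exact: powR_ge0.
Qed.

Lemma hoelder_sum alpha s : lp_norm q alpha = 1 ->
  nrm (\sum_(i < d) alpha i * s i : K^o) <= lp_norm p s.
Proof.
move=> /lp_unit_sum a1.
have sumn (F : 'I_d -> K) : nrm (\sum_i F i : K^o) <= \sum_i nrm (F i : K^o).
  apply: (big_ind2 (fun (x : K^o) y => nrm x <= y)) => //.
    by rewrite nrm0.
  by move=> x1 x2 y1 y2 h1 h2; apply: le_trans (nrmD _ _) _; rewrite lerD.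
apply: le_trans (sumn _) _.
set n := lp_norm p s; have n0 : 0 <= n := lp_norm_ge0 p s.
have np : n `^ p = \sum_(i < d) nrm (s i : K^o) `^ p := lp_norm_powR s.
have [nE|nN] := eqVneq n 0.
  rewrite nE big1 // => i _; move: np; rewrite nE powR0 ?gt_eqF// => /esym/eqP.
  rewrite psumr_eq0; last by move=> j _; exact: powR_ge0.
  move=> /allP/(_ i (mem_index_enum _)) /= /eqP/powR_eq0_eq0 si.
  by rewrite nrm_scalarM si mulr0.
have ngt0 : 0 < n by rewrite lt_def nN n0.
have h i : nrm (alpha i * s i : K^o) <=
    n * (nrm (alpha i : K^o) `^ q / q + (nrm (s i : K^o) `^ p / n `^ p) / p).
  rewrite nrm_scalarM -ler_pdivrMl// mulrCA.
  have := @conjugate_powR R (nrm (s i : K^o) / n) (nrm (alpha i : K^o)) p q.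
  rewrite divr_ge0 ?nrm_ge0// => /(_ isT isT p_gt0 q_gt0 pq_conj).
  rewrite powRM ?nrm_ge0 ?invr_ge0//.
  have -> : n^-1 `^ p = (n `^ p)^-1.
    by rewrite -powR_inv1// powRAC powR_inv1 ?powR_ge0.
  by rewrite [X in X <= _]mulrC [X in _ * X]mulrC addrC.
apply: le_trans (ler_sum _ (fun i _ => h i)) _.
rewrite -mulr_sumr big_split /= -!mulr_suml a1 -np mulfV; last first.
  by rewrite powR_eq0 negb_and nN.
by rewrite !div1r addrC pq_conj mulr1.
Qed.

Lemma lp_norm_dual_vector alpha : lp_norm q alpha = 1 ->
  lp_norm p (fun i => dual_scalar (alpha i)) = 1.
Proof.
move=> /lp_unit_sum a1; rewrite /lp_norm.
by under eq_bigr do rewrite nrm_dual_scalar; rewrite a1 powR1.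
Qed.

Lemma sum_dual_vector alpha : lp_norm q alpha = 1 ->
  \sum_(i < d) alpha i * dual_scalar (alpha i) = 1.
Proof.
move=> /lp_unit_sum a1; under eq_bigr do rewrite mul_dual_scalar.
by rewrite -(big_morph _ (@of_realD R k) (of_real0 R k)) a1 of_real1.
Qed.

(** The vector with entries [dual_scalar (alpha i)] is the unit vector of
    l_p^d normed by [alpha].  Since [1 < p], the norm is differentiable there
    with derivative [alpha], and the remainder is uniform on bounded sets. *)
Lemma lp_norm_smooth alpha (B e : R) : lp_norm q alpha = 1 -> 0 <= B -> 0 < e ->
  exists2 h, 0 < h & forall s, (forall i, nrm (s i : K^o) <= B) ->
    lp_norm p (fun i => dual_scalar (alpha i) + of_real k h * s i)
      <= 1 + h * (re_part (\sum_(i < d) alpha i * s i) + e).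
Proof.
move=> /lp_unit_sum a1 B0 e0.
(* [d.+1] rather than [d] keeps the denominator nonzero. *)
have e'0 : 0 < p * e / d.+1%:R by rewrite divr_gt0 ?mulr_gt0.
have /choice[h0 hP] : forall i, exists h0, 0 < h0 /\
    forall h (s : K), 0 < h <= h0 -> nrm (s : K^o) <= B ->
    nrm (dual_scalar (alpha i) + of_real k h * s : K^o) `^ p
      <= nrm (alpha i : K^o) `^ q + p * h * re_part (alpha i * s)
         + p * e / d.+1%:R * h.
  by move=> i; have [h h0 hh] := powR_nrm_tangent (alpha i) B0 e'0; exists h.
pose h := \big[Num.min/1]_(i < d) h0 i.
have h_gt0 : 0 < h by apply: lt_bigmin => // i _; case: (hP i).
exists h => // s sB.
have sum_le : \sum_(i < d) nrm (dual_scalar (alpha i) + of_real k h * s i : K^o) `^ p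
    <= 1 + p * h * re_part (\sum_(i < d) alpha i * s i) + p * e * h.
  apply: (@le_trans _ _ (\sum_(i < d) (nrm (alpha i : K^o) `^ q
      + p * h * re_part (alpha i * s i) + p * e / d.+1%:R * h))).
    apply: ler_sum => i _; case: (hP i) => _; apply; last exact: sB.
    by rewrite h_gt0 bigmin_le_cond.
  rewrite !big_split /= a1 -mulr_sumr re_part_sum lerD2l sumr_const card_ord.
  rewrite -[X in X <= _]mulr_natr mulrAC ler_wpM2r ?(ltW h_gt0)//.
  rewrite mulrAC ler_pdivrMr// ler_wpM2l ?ler_nat// mulr_ge0 ?(ltW p_gt0) ?(ltW e0)//.
apply: le_trans (lp_norm_tangent sum_le) _.
set x := re_part _.
have -> : (1 + p * h * x + p * e * h - 1) / p = h * (x + e); last by [].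
by field; rewrite gt_eqF.
Qed.

End Tuples.
End SmoothnessOfLp.

(** * States of the operator space *)

Section States.
Context (R : realType) (k : scalar_kind).
Local Notation K := (scalars R k).
Context (X : completeNormedModType K).
Local Notation Xd := (dual_space X).
Local Notation L := (operators X).
Local Notation Pi := (@Pi_set R k X).

(** If no [M] worked, the pairs that violate the bound for [M = n] would have a
    limit point in Pi at which [Re ys (A y) = 0] and [Re ys (T y) >= e]. *)
Lemma penalty (X_findim : finite_dimensional X) (T A : L) (e : R) :
  (forall u, Pi u -> re_part (u.2 (A u.1) : K) <= 0) ->
  (forall u, Pi u -> re_part (u.2 (A u.1) : K) = 0 ->
     re_part (u.2 (T u.1) : K) <= 0) ->
  0 < e -> exists2 M, 0 <= M & forall u, Pi u ->
    re_part (u.2 (T u.1) : K) + M * re_part (u.2 (A u.1) : K) <= e.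
Proof.
move=> A0 AT e0; apply: contrapT => nM.
have /choice[v vP] : forall n : nat, exists u, Pi u /\
    e < re_part (u.2 (T u.1) : K) + n%:R * re_part (u.2 (A u.1) : K).
  move=> n; apply: contrapT => nu; apply: nM; exists n%:R => // u uPi.
  by rewrite leNgt; apply/negP => h; apply: nu; exists u.
have [U [UU ooU]] := @ultraFilterLemma nat \oo _.
have UPi : U [set n | Pi (v n)].
  by apply: (@filterS _ _ _ setT) => [n _|]; [case: (vP n)|exact: filterT].
have [u uPi ulim] := Pi_ultra_limit X_findim UU UPi.
have reN (S : L) c : U [set n | c <= re_part ((v n).2 (S (v n).1) : K)] ->
    c <= re_part (u.2 (S u.1) : K).
  have SE (w : X * Xd) : w.2 ((- S) w.1) = - w.2 (S w.1) :> K.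
    by rewrite blin_oppE -scaleN1r blinZ scaleN1r.
  move=> h; rewrite -lerN2 -re_partN -SE.
  apply: (ultra_cvg_re_le UU (ulim (- S))); apply: filterS h => n /=.
  by rewrite SE re_partN lerN2.
have Tu : e <= re_part (u.2 (T u.1) : K).
  apply: reN; apply: (@filterS _ _ _ setT) => [n _ /=|]; last exact: filterT.
  have [nPi hn] := vP n; have := A0 _ nPi => h.
  have : n%:R * re_part ((v n).2 (A (v n).1) : K) <= 0.
    by rewrite mulr_ge0_le0.
  by lra.
have [M [M0 MT]] := blin_bound (@nrm_homogeneous R k X) T.
have Au : re_part (u.2 (A u.1) : K) = 0.
  apply/eqP; rewrite eq_le A0//=; apply/ler_addgt0Pl => r r0.
  rewrite -lerBlDl sub0r; apply: reN.
  have [N MN] : exists N : nat, M < N%:R * r.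
    exists (Num.truncn (M / r)).+1; rewrite -ltr_pdivrMr//.
    exact: truncnS_gt.
  apply: (@filterS _ _ _ [set n | (N <= n)%N]); last first.
    by apply: ooU; exact: nbhs_infty_ge.
  move=> n /= Nn; have [nPi hn] := vP n.
  have hT : re_part ((v n).2 (T (v n).1) : K) <= M.
    apply: le_trans (re_part_le_nrm _) _; apply: le_trans (Pi_le nPi _) _.
    by apply: le_trans (MT _) _; rewrite (Pi_nrm nPi) mulr1.
  have nN : N%:R * r <= n%:R * r by rewrite ler_pM2r// ler_nat.
  rewrite leNgt; apply/negP => h.
  have : n%:R * re_part ((v n).2 (A (v n).1) : K) <= n%:R * - r.
    by rewrite ler_wpM2l// ltW.
  by lra.
by have := AT u uPi Au; lra.
Qed.

(** For [G] a functional of norm [G I = 1] for the numerical radius, this is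
    the inequality [Re G(T) <= max Re V(T)], where [V] is the numerical
    range. *)
Definition state (G : L -> K^o) := linear G /\
  forall (T : L) r, (forall u, Pi u -> re_part (u.2 (T u.1) : K) <= r) ->
    re_part (G T : K) <= r.

Lemma state_nrm_le (G : L -> K^o) (T : L) r : state G ->
  (forall u, Pi u -> nrm (u.2 (T u.1)) <= r) -> nrm (G T) <= r.
Proof.
move=> [lG sG] Tr; have [w [w1 e]] := rotation (G T : K).
rewrite -(re_of_real k (nrm (G T))) -e -linear_formZ//; apply: sG => u uPi.
rewrite blin_scaleE blinZ; apply: le_trans (re_part_le_nrm _) _.
by rewrite -[w *: _]/(w * _) nrm_scalarM w1 mul1r Tr.
Qed.

(** For every [M], [G T = G (T + M A)], and by [penalty] the right-hand side
    has real part at most any [e > 0]; the same holds for all multiples of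
    [T]. *)
Lemma state_vanish (X_findim : finite_dimensional X) (G : L -> K^o) (A T : L) :
  state G -> G A = 0 ->
  (forall u, Pi u -> re_part (u.2 (A u.1) : K) <= 0) ->
  (forall u, Pi u -> re_part (u.2 (A u.1) : K) = 0 -> u.2 (T u.1) = 0) ->
  G T = 0.
Proof.
move=> [lG sG] GA A0 AT; have [w [w1 e]] := rotation (G T : K).
apply: nrm_eq0; apply/eqP; rewrite eq_le nrm_ge0 andbT.
rewrite -(re_of_real k (nrm (G T))) -e -linear_formZ//.
apply/ler_addgt0Pl => r r0; rewrite addr0.
have [|M M0 h] := @penalty X_findim (w *: T) A r A0 _ r0.
  by move=> u uPi /(AT u uPi) E; rewrite blin_scaleE blinZ E scaler0 re_part0.
have -> : G (w *: T) = G (w *: T + of_real k M *: A).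
  by rewrite linear_mapD// (linear_formZ _ A)// GA mulr0 addr0.
apply: sG => u uPi; rewrite blin_addE blinD re_partD.
rewrite [(of_real k M *: A) _]blin_scaleE [u.2 (of_real k M *: _)]blinZ.
by rewrite [X in _ + X]re_of_realM; exact: h.
Qed.

Section Uniqueness.
Context (X_findim : finite_dimensional X) (x : X) (xs : Xd).
Context (x_xs_Pi : Pi (x, xs)).
Context (t : K) (G H : L -> K^o) (t01 : 0 < t < 1).
Context (Gst : state G) (Hst : state H).
Context (GH : forall T : L, xs (T x) = t * G T + (1 - t) * H T).

Let xsx : xs x = 1. Proof. by case: x_xs_Pi. Qed.

Let st_bound (F : L -> K^o) (f : Xd) (z : X) : state F ->
  nrm (F (rank_one f z)) <= dual_space_norm f * nrm z.
Proof.
move=> Fst; apply: state_nrm_le => // u uPi /=.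
rewrite blinZ -[_ *: _]/(_ * _) nrm_scalarM ler_pM ?nrm_ge0 ?Pi_le//.
by apply: (nrm_le_opnorm_ball (@nrm_homogeneous R k X)); rewrite Pi_nrm.
Qed.

Let xs_norm : dual_space_norm xs = 1. Proof. by case: x_xs_Pi. Qed.

(** The forms [z |-> G (xs (.) z)] and [z |-> H (xs (.) z)] lie in the dual
    ball and average to [xs]. *)
Lemma state_rank_one_functional (xs_extreme : extreme_points (@dual_space_norm R k X) xs) z :
  G (rank_one xs z) = xs z.
Proof.
have mk (F : L -> K^o) : state F -> exists2 f : Xd, dual_space_norm f <= 1 &
    forall z, f z = F (rank_one xs z).
  move=> Fst.
  have Fb : (fun z => F (rank_one xs z)) \in @bounded_linear_map R k X (@nrm R k X) K^o.
    apply: (@bounded_linear_mapI _ _ _ _ _ _ 1) => [a u v|u]; last first.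
      by have := st_bound xs u Fst; rewrite xs_norm.
    case: Fst => lF _.
    rewrite -[a *: F _]/(a * F _) -linear_formZ// -linear_mapD//; congr F.
    apply: blin_eq => y.
    change ((xs y : K) *: (a *: u + v) = a *: ((xs y : K) *: u) + (xs y : K) *: v).
    by rewrite scalerDr !scalerA mulrC.
  exists (Blin Fb) => //; apply: dual_ballP => u /=.
  by have := st_bound xs u Fst; rewrite xs_norm mul1r.
have [g g1 gE] := mk G Gst; have [h h1 hE] := mk H Hst.
have [_ /(_ g h t g1 h1 t01)] := xs_extreme.
rewrite -gE; case=> [|-> //].
apply: blin_eq => u; rewrite blin_addE !blin_scaleE gE hE -[_ *: _]/(_ * _).
by rewrite -[_ *: H _]/(_ * _) -GH /= blinZ xsx scale1r.
Qed.

(** The forms [f |-> G (f (.) x)] and [f |-> H (f (.) x)] on the dual are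
    evaluations at vectors of the ball of [X], by the dual system and by
    Hahn-Banach, and these vectors average to [x]. *)
Lemma state_rank_one_vector (x_extreme : extreme_points (@nrm R k X) x) (f : Xd) :
  G (rank_one f x) = f x.
Proof.
have [s Xs] := dual_system X_findim.
have mk (F : L -> K^o) : state F -> exists2 y : X, nrm y <= 1 &
    forall f : Xd, f y = F (rank_one f x).
  move=> Fst; pose y := \sum_(e <- s) F (rank_one e.1 x) *: e.2.
  have yE (g : Xd) : g y = F (rank_one g x).
    have -> : rank_one g x = \sum_(e <- s) (g e.2 : K) *: rank_one e.1 x.
      apply: blin_eq => z; rewrite /= {1}(Xs z) blin_sum scaler_suml.
      elim: (s) => [|e s' IH]; first by rewrite !big_nil.
      rewrite !big_cons IH blin_addE blin_scaleE /= blinZ; congr (_ + _).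
      by rewrite scalerA mulrC.
    rewrite /y blin_sum; elim: (s) => [|e s' IH].
      by rewrite !big_nil -(scale0r (0 : L)) linear_formZ ?mul0r//; case: Fst.
    case: Fst IH => lF sF IH.
    rewrite !big_cons blinZ IH [F (_ + _)]linear_mapD//.
    by rewrite [F (_ *: _)]linear_formZ// [in RHS]mulrC.
  exists y => //; have [g [g1 gy]] := norming_functional y.
  rewrite -(nrm_of_real k (nrm_ge0 y)) -gy yE.
  apply: le_trans (st_bound g x Fst) _.
  by rewrite (Pi_nrm x_xs_Pi) mulr1; exact: dual_ballP.
have [y y1 yE] := mk G Gst; have [z z1 zE] := mk H Hst.
have [_ /(_ y z t y1 z1 t01)] := x_extreme.
rewrite -yE; case=> [|-> //].
rewrite [LHS]Xs [RHS]Xs; apply: eq_bigr => e _; congr (_ *: _).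
rewrite blinD !blinZ yE zE -[_ *: _]/(_ * _) -[_ *: H _]/(_ * _) -GH /= blinZ xsx.
by rewrite -[_ *: 1]/(_ * 1) mulr1.
Qed.

(** [A = f (.) x - I] satisfies [G A = 0], since both [f (.) x] and [I] have
    numerical radius at most [1] and [T |-> xs (T x)] takes the value [1] on
    them.  On Pi, [ys (A y) = f y * ys x - 1]. *)
Lemma state_face (f : Xd) (T : L) :
  (forall z, nrm (f z) <= nrm z) -> f x = 1 ->
  (forall u, Pi u -> nrm (f u.1) = 1 -> nrm (u.2 x) = 1 -> u.2 (T u.1) = 0) ->
  G T = 0.
Proof.
move=> f1 fx fT.
have x1 : nrm x = 1 := Pi_nrm x_xs_Pi.
have one (S : L) : xs (S x) = 1 -> (forall F, state F -> nrm (F S) <= 1) -> G S = 1.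
  move=> S1 Sn; apply: (eq1_of_convex t01 (Sn _ Gst) (Sn _ Hst)).
  by rewrite -GH.
have GI : G (id_operator X) = 1.
  apply: one => // F Fst; apply: state_nrm_le => // u [_ _ /= ->].
  by rewrite nrm1.
have Gf : G (rank_one f x) = 1.
  apply: one => [|F Fst]; first by rewrite /= fx scale1r.
  by apply: le_trans (st_bound _ _ Fst) _; rewrite x1 mulr1; exact: dual_ballP.
have AE u : Pi u -> u.2 ((rank_one f x - id_operator X) u.1) = f u.1 * u.2 x - 1.
  by case=> _ _ e; rewrite blin_addE blin_oppE /= blinB blinZ e.
have prod_le u : Pi u -> nrm (f u.1 * u.2 x : K^o) <= 1.
  move=> uPi; rewrite nrm_scalarM -[leRHS]mulr1 ler_pM ?nrm_ge0//.
    by rewrite (le_trans (f1 _))// Pi_nrm.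
  by rewrite (le_trans (Pi_le uPi _))// x1.
apply: (@state_vanish X_findim G (rank_one f x - id_operator X)) => //.
- have [lG _] := Gst; rewrite -scaleN1r linear_mapD// [G (_ *: _)]linear_formZ//.
  by rewrite GI Gf mulN1r subrr.
- move=> u uPi; rewrite AE// re_partB re_part1 subr_le0.
  exact: le_trans (re_part_le_nrm _) (prod_le _ uPi).
- move=> u uPi; rewrite AE// re_partB re_part1 => /eqP; rewrite subr_eq0 => /eqP.
  move=> /(eq1_of_re (prod_le _ uPi)) e.
  have := congr1 (fun z : K => nrm (z : K^o)) e; rewrite nrm_scalarM nrm1.
  have : nrm (f u.1) <= 1 by rewrite (le_trans (f1 _))// Pi_nrm.
  have : nrm (u.2 x) <= 1 by rewrite (le_trans (Pi_le uPi _))// x1.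
  have := nrm_ge0 (f u.1); have := nrm_ge0 (u.2 x).
  set a := nrm (f u.1); set b := nrm (u.2 x) => b0 a0 b1 a1 ab.
  by apply: fT => //; rewrite -/a -/b; nra.
Qed.

(** [T] differs from [xs (.) (T x)] by an operator that kills [x]. *)
Lemma state_unique_exposing (xs_extreme : extreme_points (@dual_space_norm R k X) xs)
    (f : Xd) : (forall z, nrm (f z) <= nrm z) -> f x = 1 ->
  (forall y, nrm y = 1 -> nrm (f y) = 1 -> forall g : Xd, g y = f y * g x) ->
  forall T, G T = xs (T x).
Proof.
move=> f1 fx fexp T.
have E : T = (T - rank_one xs (T x)) + rank_one xs (T x) by rewrite subrK.
rewrite {1}E linear_mapD; last by case: Gst.
rewrite state_rank_one_functional// (state_face (f := f))//; last first.
  move=> u uPi fu _.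
  rewrite -[LHS]/(comp_dual u.2 (T - rank_one xs (T x)) u.1).
  rewrite (fexp _ (Pi_nrm uPi) fu).
  have -> : comp_dual u.2 (T - rank_one xs (T x)) x = u.2 (T x - xs x *: T x) by [].
  by rewrite xsx scale1r subrr blin0 mulr0.
by rewrite add0r.
Qed.

(** Dual argument: [T] differs from [(xs o T) (.) x] by an operator whose range
    lies in the kernel of [xs]. *)
Lemma state_unique_smooth (x_extreme : extreme_points (@nrm R k X) x) :
  (forall f : Xd, (forall z, nrm (f z) <= nrm z) -> nrm (f x) = 1 ->
     forall z, f z = f x * xs z) ->
  forall T, G T = xs (T x).
Proof.
move=> xsm T; pose f := comp_dual xs T.
have E : T = (T - rank_one f x) + rank_one f x by rewrite subrK.
rewrite {1}E linear_mapD; last by case: Gst.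
rewrite state_rank_one_vector// (state_face (f := xs)) ?add0r//.
  by move=> z; apply: nrm_le_of_dual_ball; rewrite xs_norm.
move=> u uPi _ ux; rewrite (xsm u.2 (Pi_le uPi) ux) blin_addE blin_oppE /=.
by rewrite blinB blinZ xsx -[_ *: 1]/(_ * 1) mulr1 subrr mulr0.
Qed.

End Uniqueness.
End States.

(** * Exposed points and smooth points *)

Section Exposed.
Context (R : realType) (k : scalar_kind).
Local Notation K := (scalars R k).
Context (X : completeNormedModType K).
Local Notation Xd := (dual_space X).

Lemma hyperspace_kernel (E : lmodType K) (V : set E) : hyperspace V ->
  exists g : E -> K^o, linear g /\ forall y, V y <-> g y = 0.
Proof.
move=> [[V0 Vlin] [v nVv /choice[g gP]]].
have VZ a u : V u -> V (a *: u) by move=> Vu; rewrite -[_ *: _]addr0; exact: Vlin.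
have VD u w : V u -> V w -> V (u + w).
  by move=> Vu Vw; rewrite -[u]scale1r; exact: Vlin.
have VB u w : V u -> V w -> V (u - w).
  by move=> Vu Vw; apply: VD => //; rewrite -scaleN1r; exact: VZ.
have uniq (a : K) y : V (y - a *: v) -> g y = a.
  move=> Va; apply: contrapT => /eqP; rewrite -subr_eq0 => h; apply: nVv.
  have := VB _ _ Va (gP y); rewrite opprB addrC addrA subrK -scalerBl => /(VZ (g y - a)^-1).
  by rewrite scalerA mulVf// scale1r.
exists g; split=> [a u w|y].
  apply: uniq; have -> : a *: u + w - (a *: g u + g w) *: v =
      a *: (u - g u *: v) + (w - g w *: v).
    by rewrite scalerBr scalerDl scalerA opprD addrACA.
  exact: Vlin (gP u) (gP w).
split=> [Vy|gy]; first by apply: uniq; rewrite scale0r subr0.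
by have := gP y; rewrite gy scale0r subr0.
Qed.

Lemma nrm_line_continuous (x w : X) :
  continuous (fun s : R => nrm (x + of_real k s *: w)).
Proof.
move=> s; apply/cvgrPdist_lt => e e0.
have w0 : 0 < nrm w + 1 by rewrite ltr_wpDl ?nrm_ge0.
have d0 : 0 < e / (nrm w + 1) by rewrite divr_gt0.
have := nbhsx_ballx (s : R^o) _ d0; apply: filterS => r; rewrite -ball_normE /=.
rewrite ltr_pdivlMr// => sr.
have lip a b : nrm (x + of_real k a *: w) - nrm (x + of_real k b *: w) <=
    `|a - b| * nrm w.
  apply: le_trans (nrm_lerB _ _) _.
  rewrite opprD addrACA subrr add0r -scalerBl -of_realN -of_realD nrmZ.
  rewrite ler_wpM2r ?nrm_ge0//.
  have [ab|/ltW ab] := leP 0 (a - b); first by rewrite nrm_of_real// ler_norm.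
  by rewrite ler0_norm// -[a - b]opprK of_realN nrmN nrm_of_real ?oppr_ge0// opprK.
apply: le_lt_trans sr.
apply: (@le_trans _ _ (`|s - r| * nrm w)); last by rewrite ler_wpM2l// lerDl.
by rewrite ler_norml lip andbT lerNl opprB (le_trans (lip _ _))// distrC.
Qed.

(** The norm along the ray from [x] through [z] is less than [1] at [z] and
    unbounded, so it takes the value [1] again beyond [z]. *)
Lemma sphere_on_ray (x z : X) : nrm x = 1 -> nrm z < 1 ->
  exists2 c : R, c != 0 & nrm (x + of_real k c *: (z - x)) = 1.
Proof.
move=> x1 z1; pose f (s : R) := nrm (x + of_real k s *: (z - x)).
have w0 : 0 < nrm (z - x).
  have := nrm_lerB x z; rewrite x1 -[x - z]opprB nrmN; lra.
have w2 : nrm (z - x) <= 2.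
  by apply: le_trans (nrmD _ _) _; rewrite nrmN x1; move: z1; lra.
have f1 : f 1 = nrm z by rewrite /f of_real1 scale1r addrC subrK.
(* At [s = b] the vector [s *: (z - x)] has norm [2] and [x] has norm [1]. *)
pose b := 2 / nrm (z - x).
have b1 : 1 <= b by rewrite ler_pdivlMr// mul1r.
have fb : 1 <= f b.
  have := nrm_lerB (of_real k b *: (z - x)) (- x).
  rewrite nrmN x1 opprK addrC [in leRHS]addrC -/(f b) nrmZ nrm_of_real ?(le_trans _ b1)//.
  by rewrite divfK ?gt_eqF//; lra.
have cf : {within `[1, b], continuous f}.
  by apply: continuous_subspaceT; exact: nrm_line_continuous.
have [|c] := IVT b1 cf (v := 1).
  by rewrite ge_min le_max f1 (ltW z1) fb orbT.
rewrite in_itv /= => /andP[c1 _] fc; exists c => //.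
by rewrite gt_eqF// (lt_le_trans _ c1).
Qed.

(** The hyperplane misses [0], as otherwise it would contain [- x] too, so it
    is a level set [f = 1].  If [|f y| > |y|] for some [y], the hyperplane would
    contain a point of the open ball, and by [sphere_on_ray] a second point of
    the sphere. *)
Lemma exposing_functional (x : X) : exposed_point (@nrm R k X) x ->
  exists f : Xd, [/\ forall z, nrm (f z) <= nrm z, f x = 1 &
    forall y, nrm y = 1 -> nrm (f y) = 1 -> y = (f y : K) *: x].
Proof.
move=> [x1 [_ [a [V [/hyperspace_kernel[g [lg gV]] ->]]] SH]].
have gZ (b : K) u : g (b *: u) = b * g u by exact: linear_formZ.
have gD u w : g (u + w) = g u + g w by exact: linear_mapD.
have gN u : g (- u) = - g u by rewrite -scaleN1r gZ mulN1r.
have HE y : [set a + v | v in V] y <-> g y = g a.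
  split=> [[v /gV gv <-]|gy]; first by rewrite gD gv addr0.
  by exists (y - a); [apply/gV; rewrite gD gN gy subrr|rewrite addrC subrK].
have Hx y : nrm y = 1 -> g y = g a -> y = x.
  move=> y1 gy; have : [set x] y by rewrite -SH; split=> //; exact/HE.
  by [].
have gxa : g x = g a.
  by have : [set x] x by []; rewrite -SH => -[_ /HE].
have gx0 : (g x : K) != 0.
  apply/eqP => gx.
  have Nx : - x = x by apply: Hx; [rewrite nrmN|rewrite gN gx oppr0 -gxa gx].
  have := x1; rewrite /unit_sphere /=.
  have -> : x = 0.
    have : (2 : K) *: x = 0 by rewrite scaler_nat mulr2n -{1}Nx addNr.
    by move=> /eqP; rewrite scaler_eq0 pnatr_eq0 /= => /eqP.
  by rewrite nrm0 => /esym/eqP; rewrite oner_eq0.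
pose h (y : X) : K^o := (g x : K)^-1 * g y.
have hx : h x = 1 by rewrite /h mulVf.
have hZ (b : K) u : h (b *: u) = b * h u by rewrite /h gZ mulrCA.
have hH y : nrm y = 1 -> h y = 1 -> y = x.
  move=> y1 hy; apply: Hx => //; rewrite -gxa.
  by apply: (mulfI (invr_neq0 gx0)); rewrite -[LHS]/(h y) hy mulVf.
have hle y : nrm (h y) <= nrm y.
  rewrite leNgt; apply/negP => yh.
  have hy0 : (h y : K) != 0.
    by apply: contraTneq yh => ->; rewrite nrm0 -leNgt nrm_ge0.
  pose z := (h y : K)^-1 *: y.
  have hy1 : 0 < nrm (h y) by apply: le_lt_trans yh; exact: nrm_ge0.
  have z1 : nrm z < 1 by rewrite nrmZ nrmV mulrC ltr_pdivrMr// mul1r.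
  have hz : h z = 1 by rewrite hZ mulVf.
  have [c c0 xc1] := sphere_on_ray x1 z1.
  have xc : x + of_real k c *: (z - x) = x.
    apply: hH => //; rewrite /h gD gZ gD gN.
    have -> : g z = g x.
      by apply: (mulfI (invr_neq0 gx0)); rewrite -[LHS]/(h z) hz mulVf.
    by rewrite subrr mulr0 addr0 mulVf.
  have zx : z = x.
    apply/eqP; rewrite -subr_eq0; move/eqP: xc.
    rewrite -subr_eq0 addrAC subrr add0r scaler_eq0 => /orP[/eqP h0|//].
    by move: c0; rewrite -(re_of_real k c) h0 re_part0 eqxx.
  by move: z1; rewrite zx x1 ltxx.
have hb : h \in @bounded_linear_map R k X (@nrm R k X) K^o.
  apply: (@bounded_linear_mapI _ _ _ _ _ _ 1) => [b u w|u]; last by rewrite mul1r.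
  by rewrite /h gD gZ mulrDr mulrCA.
exists (Blin hb); split=> //= y y1 hy1.
have hy0 : (h y : K) != 0 by exact: nrm1_neq0.
have <- : (h y : K)^-1 *: y = x.
  apply: hH; last by rewrite hZ mulVf.
  by rewrite nrmZ nrmV hy1 invr1 mul1r.
by rewrite scalerA mulfV// scale1r.
Qed.

End Exposed.

Section Smooth.
Context (R : realType) (k : scalar_kind).
Local Notation K := (scalars R k).
Context (X : completeNormedModType K).
Local Notation Xd := (dual_space X).
Context (x : X) (xs : Xd) (x_xs_Pi : Pi_set (x, xs)).

(** A functional of norm [1] with [|f x| = 1] norms [x] after a rotation. *)
Lemma smooth_vector : smooth (@nrm R k X) x ->
  forall f : Xd, (forall z, nrm (f z) <= nrm z) -> nrm (f x) = 1 ->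
    forall z, f z = f x * xs z.
Proof.
case: x_xs_Pi => /= x1 xs1 xsx [_ [g xg]] f f1 fx z.
have {xg} xg h : dual_space_norm h = 1 -> h x = 1 -> h = g.
  move=> h1 hx; have : [set g] h by rewrite -xg; split=> //; rewrite hx x1 of_real1.
  by [].
have fx0 : (f x : K) != 0 by exact: nrm1_neq0.
have hE u : ((f x : K)^-1 *: f) u = (f x : K)^-1 * f u by [].
have hPi : Pi_set (x, (f x : K)^-1 *: f).
  apply: PiI => [|u|]; first by rewrite x1.
    by rewrite hE nrm_scalarM nrmV fx invr1 mul1r.
  by rewrite hE mulVf.
have e : (f x : K)^-1 *: f = xs.
  by rewrite (xg xs)// (xg ((f x : K)^-1 *: f))//; case: hPi.
by rewrite -e hE mulrA mulfV// mul1r.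
Qed.

Fact evaluation_proof (y : X) : (fun f : Xd => f y) \in
  @bounded_linear_map R k Xd (@dual_space_norm R k X) K^o.
Proof.
apply: (@bounded_linear_mapI _ _ _ _ _ _ (nrm y)) => [a f g|f]; first by [].
by rewrite mulrC; exact: nrm_le_dual.
Qed.
Definition evaluation (y : X) : dual (@dual_space_norm R k X) :=
  Blin (evaluation_proof y).

(** Evaluations at unit vectors on which [xs] is [1] norm [xs], so they all
    coincide.  The conclusion is phrased with functionals, because it is only
    as elements of the bidual that [y] and [x] are compared. *)
Lemma smooth_functional : smooth (@dual_space_norm R k X) xs ->
  forall y, nrm y = 1 -> nrm (xs y) = 1 -> forall f : Xd, f y = xs y * f x.
Proof.
case: x_xs_Pi => /= x1 xs1 xsx [_ [G xsG]] y y1 xsy f.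
have ev z : nrm z <= 1 -> xs z = 1 -> evaluation z = G.
  move=> z1 xsz; have : [set G] (evaluation z).
    rewrite -xsG; split; last by rewrite /= xs1 of_real1.
    apply/eqP; rewrite eq_le; apply/andP; split.
      apply: (opnorm_le (@dual_homogeneous R k X)) => g g1 /=.
      by apply: le_trans (nrm_le_of_dual_ball _ g1) _.
    rewrite -(nrm1 R k) -xsz -[xs z]/(evaluation z xs).
    by apply: (nrm_le_opnorm_ball (@dual_homogeneous R k X)); rewrite xs1.
  by [].
have xsy0 : (xs y : K) != 0 by exact: nrm1_neq0.
have e : evaluation ((xs y : K)^-1 *: y) = evaluation x.
  rewrite (ev x) ?x1// ev//.
    by rewrite nrmZ nrmV xsy y1 invr1 mulr1.
  by rewrite blinZ -[_ *: _]/(_ * _) mulVf.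
rewrite -[f x]/(evaluation x f) -e /= blinZ -[_ *: f y]/(_ * f y).
by rewrite mulrA mulfV// mul1r.
Qed.

End Smooth.

(** * The joint numerical radius and its dual ball *)

Section JointNumericalRadius.
Context (R : realType) (k : scalar_kind).
Local Notation K := (scalars R k).
Context (X : completeNormedModType K).
Local Notation Xd := (dual_space X).
Local Notation L := (operators X).
Local Notation Pi := (@Pi_set R k X).
Context (p q : R) (p_gt1 : 1 < p) (pq_conj : p^-1 + q^-1 = 1).
Context (d : nat).
Local Notation Z := (operator_tuples X d).
Local Notation wp := (@joint_numerical_radius R k X p d).
Context (x : X) (xs : Xd) (x_xs_Pi : Pi (x, xs)).

Lemma tuple_bound (T : Z) : exists2 B, 0 <= B &
  forall u, Pi u -> forall i, nrm (u.2 (T i u.1)) <= B.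
Proof.
have /choice[M MP] : forall i, exists M, 0 <= M /\ forall u, nrm (T i u) <= M * nrm u.
  by move=> i; exact: (blin_bound (@nrm_homogeneous R k X)).
exists (\sum_i M i); first by apply: sumr_ge0 => i _; case: (MP i).
move=> u uPi i; apply: le_trans (Pi_le uPi _) _.
apply: le_trans ((MP i).2 _) _; rewrite (Pi_nrm uPi) mulr1 (bigD1 i)//= lerDl.
by apply: sumr_ge0 => j _; case: (MP j).
Qed.

Lemma le_joint (T : Z) u : Pi u -> lp_norm p (fun i => u.2 (T i u.1) : K) <= wp T.
Proof.
move=> uPi; apply: ub_le_sup; last by exists u.
have [B B0 TB] := tuple_bound T.
exists (lp_norm p (fun i : 'I_d => of_real k B)) => _ [v vPi <-].
have p0 : 0 <= p by rewrite ltW// (lt_trans _ p_gt1).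
apply: ge0_ler_powR; rewrite ?invr_ge0// ?nnegrE.
- by apply: sumr_ge0 => i _; exact: powR_ge0.
- by apply: sumr_ge0 => i _; exact: powR_ge0.
- apply: ler_sum => i _; apply: ge0_ler_powR; rewrite ?nnegrE ?nrm_ge0//.
  by rewrite nrm_of_real// TB.
Qed.

Lemma joint_le (T : Z) c :
  (forall u, Pi u -> lp_norm p (fun i => u.2 (T i u.1) : K) <= c) -> wp T <= c.
Proof.
move=> h; apply: ge_sup; last by move=> _ [u uPi <-]; exact: h.
by eexists; exists (x, xs).
Qed.

Lemma joint_homogeneous : homogeneous wp.
Proof.
have ge0 T : 0 <= wp T by apply: le_trans (le_joint T x_xs_Pi); exact: powR_ge0.
have le (a : K) (T : Z) : wp (a *: T) <= nrm (a : K^o) * wp T.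
  apply: joint_le => u uPi.
  have -> : (fun i => u.2 ((a *: T) i u.1) : K) = (fun i => a * (u.2 (T i u.1) : K)).
    by apply: funext => i; rewrite -[(a *: T) i u.1]/(a *: T i u.1) blinZ.
  by rewrite (lp_norm_scale p_gt1) ler_wpM2l ?nrm_ge0// le_joint.
split=> // a T; apply/eqP; rewrite eq_le le /=; have [->|a0] := eqVneq a 0.
  by rewrite nrm0 mul0r.
have n0 : 0 < nrm (a : K^o) by exact: nrm_gt0.
rewrite mulrC -ler_pdivlMr// mulrC -nrmV.
have e : a^-1 *: (a *: T) = T :> Z by rewrite (scalerA a^-1 a T) (mulVf a0) scale1r.
by have := le a^-1 (a *: T); rewrite e.
Qed.

Context (alpha : 'I_d -> K) (alpha_unit : lp_norm q alpha = 1).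

Definition combine (S : Z) : L := \sum_(i < d) alpha i *: S i.

Lemma combineE (S : Z) (u : X * Xd) :
  u.2 (combine S u.1) = \sum_(i < d) alpha i * (u.2 (S i u.1) : K).
Proof.
have sumE (s : seq 'I_d) y : (\sum_(i <- s) alpha i *: S i : L) y =
    \sum_(i <- s) alpha i *: S i y.
  elim: s => [|i s IH]; first by rewrite !big_nil.
  by rewrite !big_cons blin_addE IH.
by rewrite /combine sumE blin_sum; apply: eq_bigr => i _; rewrite blinZ.
Qed.

(** A right inverse of [combine] which maps [I] to the tuple where the norm
    is differentiated. *)
Definition spread (T : L) : Z := fun i => dual_scalar q (alpha i) *: T.

Lemma combine_spread T : combine (spread T) = T.
Proof.
rewrite /combine /spread; under eq_bigr do rewrite scalerA.
by rewrite -scaler_suml (sum_dual_vector p_gt1 pq_conj alpha_unit) scale1r.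
Qed.

Lemma combine_linear : linear combine.
Proof.
move=> a S T; rewrite /combine scaler_sumr -big_split; apply: eq_bigr => i _ /=.
by rewrite -[(a *: S + T) i]/(a *: S i + T i) scalerDr !scalerA mulrC.
Qed.

Section DualBall.
Context (g : dual wp) (g1 : dual_norm g <= 1) (gC : g (spread (id_operator X)) = 1).

(** First-order comparison of [Re g T <= wp T] at [T = (c_i I) + h *: S], where
    both sides are [1] for [h = 0]. *)
Lemma dual_ball_re_le (S : Z) (r : R) :
  (forall u, Pi u -> re_part (u.2 (combine S u.1) : K) <= r) ->
  re_part (g S : K) <= r.
Proof.
move=> Sr; apply/ler_addgt0Pl => e e0.
have [B B0 SB] := tuple_bound S.
have [h h0 hP] := lp_norm_smooth p_gt1 pq_conj alpha_unit B0 e0.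
pose T : Z := spread (id_operator X) + of_real k h *: S.
have NT : wp T <= 1 + h * (r + e).
  apply: joint_le => u uPi.
  have -> : (fun i => u.2 (T i u.1) : K) =
     (fun i => dual_scalar q (alpha i) + of_real k h * (u.2 (S i u.1) : K)).
    apply: funext => i.
    rewrite -[T i u.1]/(dual_scalar q (alpha i) *: u.1 + of_real k h *: S i u.1).
    rewrite blinD !blinZ; case: uPi => _ _ ->.
    by rewrite -[_ *: 1]/(_ * 1) mulr1.
  apply: le_trans (hP _ (SB u uPi)) _.
  by rewrite lerD2l ler_pM2l// lerD2r -combineE Sr.
have gT : nrm (g T) <= wp T.
  apply: le_trans (nrm_le_opnorm joint_homogeneous g T) _.
  by rewrite ler_piMl//; case: joint_homogeneous.
have := le_trans (le_trans (re_part_le_nrm (g T : K)) gT) NT.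
rewrite blinD gC blinZ re_partD re_part1 -[_ *: g S]/(_ * g S) re_of_realM.
by rewrite lerD2l ler_pM2l// addrC.
Qed.

(** The difference of both tuples is annihilated by [combine], and so are its
    multiples; [dual_ball_re_le] with [r = 0] applies to all of them. *)
Lemma dual_ball_factor (S : Z) : g S = g (spread (combine S)).
Proof.
have spread_linear : linear spread.
  move=> a T1 T2; apply: funext => i.
  change (dual_scalar q (alpha i) *: (a *: T1 + T2) =
    a *: (dual_scalar q (alpha i) *: T1) + dual_scalar q (alpha i) *: T2).
  by rewrite scalerDr !scalerA mulrC.
apply/eqP; rewrite -subr_eq0 -blinB; apply/eqP.
set D := S - _.
have D0 : combine D = 0.
  have -> : D = (-1) *: spread (combine S) + S by rewrite scaleN1r addrC.
  by rewrite combine_linear combine_spread scaleN1r addNr.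
have [w [w1 e]] := rotation (g D : K).
apply: nrm_eq0; apply/eqP; rewrite eq_le nrm_ge0 andbT.
rewrite -(re_of_real k (nrm (g D))) -e -[w * g D]/(w *: g D) -blinZ.
apply: dual_ball_re_le => u uPi.
have -> : combine (w *: D) = 0.
  have := combine_linear w D 0; rewrite addr0 => ->; rewrite D0 scaler0 add0r.
  by rewrite /combine big1// => i _; rewrite scaler0.
by rewrite -[(0 : L) u.1]/(0 : X) blin0 re_part0.
Qed.

Lemma dual_ball_state : state (fun T => g (spread T)).
Proof.
split=> [a S T|T r Tr]; last by apply: dual_ball_re_le; rewrite combine_spread.
rewrite -blinP; congr (g _); apply: funext => i.
change (dual_scalar q (alpha i) *: (a *: S + T) =
    a *: (dual_scalar q (alpha i) *: S) + dual_scalar q (alpha i) *: T).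
by rewrite scalerDr !scalerA mulrC.
Qed.

End DualBall.

Fact tensor_functional_proof :
  tensor_functional alpha xs x \in @bounded_linear_map R k Z wp K^o.
Proof.
apply: (@bounded_linear_mapI _ _ _ _ _ _ 1) => [a S T|T].
  rewrite /tensor_functional -[a *: \sum_(_ < _) _]/(a * _) mulr_sumr -big_split.
  apply: eq_bigr => i _.
  transitivity (alpha i * (xs (a *: S i x + T i x) : K)); first by [].
  by rewrite blinP mulrDr -[a *: xs _]/(a * xs _) mulrCA.
rewrite mul1r; apply: le_trans (le_joint T x_xs_Pi).
exact: (hoelder_sum p_gt1 pq_conj _ alpha_unit).
Qed.

Lemma tensor_functionalE (S : Z) : tensor_functional alpha xs x S = xs (combine S x).
Proof. by have := combineE S (x, xs) => /= ->. Qed.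

(** The functional is [xs (combine S x)], so both it and the two functionals
    [g], [h] factor through [combine], and only states have to be compared. *)
Lemma tensor_extreme
  (uniqueness : forall (t : K) (G H : L -> K^o), 0 < t < 1 -> state G -> state H ->
     (forall T : L, xs (T x) = t * G T + (1 - t) * H T) ->
     forall T : L, G T = xs (T x)) :
  extreme_points (@dual_norm R k _ wp) (Blin tensor_functional_proof).
Proof.
set f := Blin _.
have fE S : f S = xs (combine S x) by exact: tensor_functionalE.
have xsx : xs x = 1 by case: x_xs_Pi.
have N1 : wp (spread (id_operator X)) <= 1.
  apply: joint_le => u uPi; rewrite -(lp_norm_dual_vector p_gt1 pq_conj alpha_unit).
  rewrite le_eqVlt; apply/orP; left; apply/eqP; congr (lp_norm p _).
  apply: funext => i.
  rewrite -[spread _ i u.1]/(dual_scalar q (alpha i) *: u.1) blinZ.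
  by case: uPi => _ _ ->; rewrite -[_ *: 1]/(_ * 1) mulr1.
have key (g h : dual wp) (t : K) : dual_norm g <= 1 -> dual_norm h <= 1 ->
    0 < t < 1 -> f = t *: g + (1 - t) *: h -> g = f.
  move=> g1 h1 t01 e.
  have eS S : xs (combine S x) = t * g S + (1 - t) * h S by rewrite -fE e.
  have C1 : xs (combine (spread (id_operator X)) x) = 1 by rewrite combine_spread.
  have leC (F : dual wp) : dual_norm F <= 1 -> nrm (F (spread (id_operator X))) <= 1.
    by apply: le_trans; exact: (nrm_le_opnorm_ball joint_homogeneous).
  have gC : g (spread (id_operator X)) = 1.
    by apply: (eq1_of_convex t01 (leC g g1) (leC h h1)); rewrite -eS.
  have t'01 : 0 < 1 - t < 1.
    by case/andP: t01 => t0 t1; rewrite subr_gt0 t1 ltrBlDr ltrDl.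
  have hC : h (spread (id_operator X)) = 1.
    apply: (eq1_of_convex t'01 (leC h h1) (leC g g1)).
    by rewrite subKr addrC -eS.
  apply: blin_eq => S; rewrite fE (dual_ball_factor g1 gC).
  apply: (uniqueness t (fun T => g (spread T)) (fun T => h (spread T)) t01 _ _ _
    (combine S)).
  - exact: dual_ball_state.
  - exact: dual_ball_state.
  - by move=> T; rewrite -eS combine_spread.
split.
  apply: (opnorm_le joint_homogeneous) => T T1; apply: le_trans T1.
  apply: le_trans (le_joint T x_xs_Pi).
  exact: (hoelder_sum p_gt1 pq_conj _ alpha_unit).
move=> g h t g1 h1 t01 e; split; first exact: key e.
apply: (key h g (1 - t)) => //; last by rewrite subKr addrC.
by case/andP: t01 => t0 t1; rewrite subr_gt0 t1 ltrBlDr ltrDl.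
Qed.

End JointNumericalRadius.

Unset Implicit Arguments.

Theorem theorem2p6 (R : realType) (k : scalar_kind)
  (X : completeNormedModType (scalars R k))
  (X_nonzero : exists v : X, v <> 0)
  (w_norm : is_norm (@numerical_radius R k X))
  (d : nat) (d_ge1 : (1 <= d)%N)
  (p q : R) (p_gt1 : 1 < p) (pq_conj : p^-1 + q^-1 = 1)
  (X_findim : finite_dimensional X)
  (x : X) (xs : dual_space X)
  (x_xs_Pi : Pi_set (x, xs))
  (x_extreme : extreme_points (@nrm R k X) x)
  (xs_extreme : extreme_points (@dual_space_norm R k X) xs)
  (smooth_or_exposed :
    (smooth (@nrm R k X) x \/ smooth (@dual_space_norm R k X) xs)
    \/ exposed_point (@nrm R k X) x)
  (alpha : 'I_d -> scalars R k) (alpha_unit : lp_norm q alpha = 1) :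
  exists2 f : dual (@joint_numerical_radius R k X p d),
    extreme_points (@dual_norm R k _ (@joint_numerical_radius R k X p d)) f &
    blin_fun f = tensor_functional alpha xs x.
Proof.
exists (Blin (tensor_functional_proof p_gt1 pq_conj x_xs_Pi alpha_unit)) => //.
apply: tensor_extreme => t G H t01 Gst Hst GH.
case: smooth_or_exposed => [[x_smooth|xs_smooth]|/exposing_functional[f [f1 fx fexp]]].
- apply: (state_unique_smooth X_findim x_xs_Pi t01 Gst Hst GH x_extreme).
  exact: smooth_vector.
- apply: (state_unique_exposing X_findim x_xs_Pi t01 Gst Hst GH xs_extreme (f := xs)).
  + by move=> z; apply: nrm_le_of_dual_ball; case: x_xs_Pi => _ /= ->.
  + by case: x_xs_Pi.
  + exact: smooth_functional.
- apply: (state_unique_exposing X_findim x_xs_Pi t01 Gst Hst GH xs_extreme f1 fx).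
  by move=> y y1 fy g; rewrite {1}(fexp y y1 fy) blinZ.
Qed.
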